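(* Let $(M,\omega)$ be a compact, connected, quantizable symplectic manifold with prequantum bundle $(L,D)$, let $\{\psi_t\}_{t\in[0,1]}$ be a Hamiltonian isotopy of $M$ with time-dependent Hamiltonian $f_t$ and Hamiltonian vector fields $X_t$, and let $\{F_t\}$ be its lift to $L^\times$. Let $\tau$ be a local section of $L^\times$. The family of sections $\tau_t$ defined by $\tau_t=F_t\circ\tau\circ\psi_t^{-1}$ is the solution to the equation $$\frac{d\tau_t}{dt}=-D_{X_t}\tau_t-2\pi i f_t\tau_t,\qquad \tau_0=\tau .$$
   Context: $(M,\omega)$ is quantizable: $[\omega]$ is integral, so there is a prequantum bundle, i.e. a Hermitian line bundle $\pi:L\to M$ with a connection $D$ whose curvature is $-2\pi i\omega$. $L^\times=L\setminus\{\text{zero section}\}$ is the associated $\mathbb{C}^\times$-principal bundle. For a function $f$ on $M$, $W_f$ is the vertical vector field on $L^\times$ whose value at $p$ is the tangent vector at $t=0$ of the curve $t\mapsto p\cdot e^{2\pi i t f(\pi(p))}$; for a vector field $X$ on $M$, $X^\sharp$ is its horizontal lift to $L^\times$. The isotopy $\psi_t$ is determined by $\frac{d\psi_t(x)}{dt}=X_t(\psi_t(x))$, $\psi_0=\mathrm{id}$, with $\iota_{X_t}\omega=-df_t$. The lift of $\psi_t$ is the isotopy $\{F_t\}$ of $L^\times$, $F_0=\mathrm{id}$, generated by the vector fields $X_t^\sharp-W_{f_t}$; it consists of connection-preserving diffeomorphisms with $\pi\circ F_t=\psi_t\circ\pi$. *)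

(* Defs.v *)
From mathcomp Require Export all_boot all_order all_algebra.
From mathcomp Require Export all_classical all_reals all_analysis.
From mathcomp Require Export complex.
Export Order.TTheory GRing.Theory Num.Theory.
Export numFieldNormedType.Exports.

Set Implicit Arguments.
Unset Strict Implicit.
Unset Printing Implicit Defensive.

Local Open Scope classical_set_scope.
Local Open Scope ring_scope.

(* C^k on an open subset O of a finite-dimensional space: f is differentiable
   on O and all its directional derivatives are C^(k-1) on O. *)
Fixpoint Ck_on (R : realType) (E F : normedModType R) (k : nat) (O : set E)
    (f : E -> F) : Prop :=
  if k is k'.+1 then
    (forall x, O x -> differentiable f x) /\
    (forall v, Ck_on k' O (fun x => 'D_v f x))
  else forall x, O x -> {for x, continuous f}.

Definition smooth_on (R : realType) (E F : normedModType R) (O : set E)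
  (f : E -> F) : Prop := forall k, Ck_on k O f.

(* chart_map i is only meaningful on chart_dom i, and chart_inv i only on
   chart_map i @` chart_dom i. *)
Record atlas (R : realType) (E : normedModType R) (T : Type) := Atlas {
  chart_idx : Type;
  chart_dom : chart_idx -> set T;
  chart_map : chart_idx -> T -> E;
  chart_inv : chart_idx -> E -> T }.

Definition chart_img (R : realType) (E : normedModType R) (T : Type)
  (a : atlas E T) (i : chart_idx a) (S : set T) : set E :=
  chart_map i @` (chart_dom i `&` S).

Definition is_manifold (R : realType) (E : normedModType R)
    (T : topologicalType) (a : atlas E T) : Prop :=
  [/\ hausdorff_space T /\ @second_countable T,
      forall x : T, exists i, chart_dom (a := a) i x,
      forall i : chart_idx a,
        [/\ open (chart_dom i), open (chart_img i setT),
            forall x, chart_dom i x -> chart_inv i (chart_map i x) = x,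
            {within chart_dom i, continuous (chart_map i)} &
            {within chart_img i setT, continuous (chart_inv i)}] &
      forall i j : chart_idx a,
        smooth_on (chart_img i (chart_dom j)) (chart_map j \o chart_inv i)].

Record manifold (R : realType) (n : nat) := Manifold {
  mcar :> topologicalType;
  matlas : atlas 'rV[R]_n mcar;
  manifoldP : is_manifold matlas }.

Definition vsp_atlas (R : realType) (E : normedModType R) : atlas E E :=
  @Atlas R E E unit (fun=> setT) (fun=> id) (fun=> id).

Definition cyl_atlas (R : realType) (E : normedModType R) (T : Type)
    (a : atlas E T) : atlas (R * E)%type (R * T)%type :=
  @Atlas R (R * E)%type (R * T)%type (chart_idx a)
    (fun i => [set p | chart_dom i p.2])
    (fun i p => (p.1, chart_map i p.2))
    (fun i p => (p.1, chart_inv i p.2)).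

Definition unitI (R : realType) : set R := [set t | 0 <= t <= 1].

(* The coordinate expression of f is required to extend smoothly to an open
   set O: this gives the usual notion both for S open in T and, in cyl_atlas,
   for S relatively open in [0,1] x T (a manifold with boundary). *)
Definition smooth_map (R : realType) (E F : normedModType R) (T T' : Type)
    (a : atlas E T) (b : atlas F T') (S : set T) (f : T -> T') : Prop :=
  forall p, S p ->
    exists (i : chart_idx a) (k : chart_idx b),
      [/\ chart_dom i p, chart_dom k (f p) &
          exists (O : set E) (g : E -> F),
            [/\ open O, O (chart_map i p), smooth_on O g &
                forall q, S q -> chart_dom i q -> O (chart_map i q) ->
                  chart_dom k (f q) /\ chart_map k (f q) = g (chart_map i q)]].

(* A tangent vector at x is the family of its components in the charts around
   x, normalised to 0 in the other charts, so that equality of tangent vectors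
   is equality of families. *)
Definition is_tangent (R : realType) (E : normedModType R) (T : Type)
    (a : atlas E T) (x : T) (v : chart_idx a -> E) : Prop :=
  (forall i j, chart_dom i x -> chart_dom j x ->
     v j = 'D_(v i) (chart_map j \o chart_inv i) (chart_map i x)) /\
  (forall i, ~ chart_dom i x -> v i = 0).

(* The derivative of g along v, computed in the chart i. *)
Definition along (R : realType) (E F : normedModType R) (T : Type)
    (a : atlas E T) (i : chart_idx a) (v : chart_idx a -> E) (g : T -> F)
    (x : T) : F :=
  'D_(v i) (g \o chart_inv i) (chart_map i x).

Definition is_pushforward (R : realType) (E F : normedModType R) (T T' : Type)
    (a : atlas E T) (b : atlas F T') (f : T -> T') (x : T)
    (v : chart_idx a -> E) (w : chart_idx b -> F) : Prop :=
  is_tangent (f x) w /\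
  (forall i k, chart_dom i x -> chart_dom k (f x) ->
     w k = along i v (chart_map k \o f) x).

(* One-sided at a boundary point t of the interval A. *)
Definition has_deriv_within (R : realType) (F : normedModType R) (A : set R)
    (c : R -> F) (t : R) (v : F) : Prop :=
  (fun s => (s - t)^-1 *: (c s - c t)) @ within A t^' --> v.

Definition is_velocity (R : realType) (E : normedModType R) (T : Type)
    (a : atlas E T) (A : set R) (c : R -> T) (t : R)
    (v : chart_idx a -> E) : Prop :=
  is_tangent (c t) v /\
  (forall k, chart_dom k (c t) ->
     (\forall s \near within A (nbhs t), chart_dom k (c s)) /\
     has_deriv_within A (chart_map k \o c) t (v k)).

(* F' t is the inverse of F t; the joint smoothness of F and F' says that
   (t, x) |-> (t, F t x) is a diffeomorphism of [0,1] x S. *)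
Definition isotopy (R : realType) (E : normedModType R) (T : Type)
    (a : atlas E T) (S : set T) (F F' : R -> T -> T) : Prop :=
  [/\ forall t x, unitI t -> S x -> S (F t x) /\ S (F' t x),
      forall t x, unitI t -> S x -> F' t (F t x) = x /\ F t (F' t x) = x,
      smooth_map (cyl_atlas a) a (unitI (R := R) `*` S) (fun p => F p.1 p.2),
      smooth_map (cyl_atlas a) a (unitI (R := R) `*` S) (fun p => F' p.1 p.2) &
      forall x, S x -> F 0 x = x].

Definition tvec (R : realType) (n : nat) (M : manifold R n) : Type :=
  chart_idx (matlas M) -> 'rV[R]_n.

Definition smooth_vfield (R : realType) (n : nat) (M : manifold R n)
    (U : set M) (X : M -> tvec M) : Prop :=
  (forall x, U x -> is_tangent x (X x)) /\
  (forall i : chart_idx (matlas M),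
     smooth_map (matlas M) (vsp_atlas 'rV[R]_n) (U `&` chart_dom i)
       (fun x => X x i)).

Definition lie (R : realType) (n : nat) (M : manifold R n) (X Y : M -> tvec M)
    : M -> tvec M :=
  fun x i => if `[< chart_dom i x >]
             then along i (X x) (Y^~ i) x - along i (Y x) (X^~ i) x else 0.

(* The exterior derivative is given by the invariant formula
   dw(X,Y,Z) = X w(Y,Z) + Y w(Z,X) + Z w(X,Y)
               - w([X,Y],Z) - w([Y,Z],X) - w([Z,X],Y). *)
Record symplectic_form (R : realType) (n : nat) (M : manifold R n) :=
  SymplecticForm {
  omega :> M -> tvec M -> tvec M -> R;
  omega_linear : forall x c (u v w : tvec M),
    is_tangent x u -> is_tangent x v -> is_tangent x w ->
    omega x (c *: u + v) w = c * omega x u w + omega x v w;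
  omega_alt : forall x (u v : tvec M), is_tangent x u -> is_tangent x v ->
    omega x u v = - omega x v u;
  omega_smooth : forall (U : set M) (X Y : M -> tvec M),
    open U -> smooth_vfield U X -> smooth_vfield U Y ->
    smooth_map (matlas M) (vsp_atlas R) U (fun x => omega x (X x) (Y x));
  omega_closed : forall (U : set M) (X Y Z : M -> tvec M),
    open U -> smooth_vfield U X -> smooth_vfield U Y -> smooth_vfield U Z ->
    forall x i, U x -> chart_dom i x ->
      along i (X x) (fun y => omega y (Y y) (Z y)) x
      + along i (Y x) (fun y => omega y (Z y) (X y)) x
      + along i (Z x) (fun y => omega y (X y) (Y y)) x
      - omega x (lie X Y x) (Z x)
      - omega x (lie Y Z x) (X x)
      - omega x (lie Z X x) (Y x) = 0;
  omega_nondegenerate : forall x (v : tvec M), is_tangent x v ->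
    (forall w, is_tangent x w -> omega x v w = 0) -> v = 0 }.

(* The identification of C with the real normed space R x R. *)
Definition c2 (R : realType) (z : R[i]) : (R * R)%type :=
  (complex.Re z, complex.Im z).
Definition r2c (R : realType) (p : (R * R)%type) : R[i] := (p.1 +i* p.2)%C.

Record line_bundle (R : realType) (n : nat) (M : manifold R n) := LineBundle {
  fib :> M -> lmodType R[i];
  triv_idx : Type;
  triv_dom : triv_idx -> set M;
  triv : forall (j : triv_idx) (x : M), fib x -> R[i];
  triv_inv : forall (j : triv_idx) (x : M), R[i] -> fib x;
  triv_open : forall j, open (triv_dom j);
  triv_cover : forall x, exists j, triv_dom j x;
  triv_linear : forall j x, triv_dom j x -> forall c (l m : fib x),
    triv j (c *: l + m) = c * triv j l + triv j m;
  trivK : forall j x, triv_dom j x -> cancel (@triv j x) (@triv_inv j x);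
  triv_invK : forall j x, triv_dom j x -> cancel (@triv_inv j x) (@triv j x);
  triv_smooth : forall j k,
    smooth_map (matlas M) (vsp_atlas (R * R)%type)
      (triv_dom j `&` triv_dom k)
      (fun x => c2 (triv j (triv_inv k x 1))) }.

(* The total space; base is the projection pi. *)
Record tot (R : realType) (n : nat) (M : manifold R n) (L : line_bundle M) :=
  Tot { base : M; vec : L base }.
Arguments Tot {R n M} L base vec.

Definition tot_atlas (R : realType) (n : nat) (M : manifold R n)
    (L : line_bundle M) : atlas ('rV[R]_n * (R * R))%type (tot L) :=
  @Atlas R ('rV[R]_n * (R * R))%type (tot L)
    (chart_idx (matlas M) * triv_idx L)%type
    (fun ij => [set p | chart_dom ij.1 (base p) /\ triv_dom ij.2 (base p)])
    (fun ij p => (chart_map ij.1 (base p), c2 (triv ij.2 (vec p))))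
    (fun ij e => Tot L (chart_inv ij.1 e.1)
                   (triv_inv ij.2 (chart_inv ij.1 e.1) (r2c e.2))).

(* The complement of the zero section. *)
Definition Lx (R : realType) (n : nat) (M : manifold R n) (L : line_bundle M)
  : set (tot L) := [set p | vec p != 0].
Arguments Lx {R n M} L _.

Definition smooth_section (R : realType) (n : nat) (M : manifold R n)
    (L : line_bundle M) (U : set M) (s : forall x, L x) : Prop :=
  smooth_map (matlas M) (tot_atlas L) U (fun x => Tot L x (s x)).

Definition smooth_near (R : realType) (n : nat) (M : manifold R n)
    (L : line_bundle M) (x : M) (s : forall x, L x) : Prop :=
  exists U : set M, [/\ open U, U x & smooth_section U s].

Record hermitian (R : realType) (n : nat) (M : manifold R n)
    (L : line_bundle M) := Hermitian {
  herm :> forall x, L x -> L x -> R[i];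
  herm_linear : forall x c (l m k : L x),
    herm (c *: l + m) k = c * herm l k + herm m k;
  herm_conj : forall x (l m : L x), herm m l = ((herm l m)^*)%C;
  herm_pos : forall x (l : L x), l != 0 -> 0 < herm l l;
  herm_smooth : forall (U : set M) (s s' : forall x, L x),
    open U -> smooth_section U s -> smooth_section U s' ->
    smooth_map (matlas M) (vsp_atlas (R * R)%type) U
      (fun x => c2 (herm (s x) (s' x))) }.

(* conn x v s is D_v s at x; it is only meaningful for v tangent at x and s
   smooth near x. *)
Record connection (R : realType) (n : nat) (M : manifold R n)
    (L : line_bundle M) := Connection {
  conn :> forall x : M, tvec M -> (forall y, L y) -> L x;
  conn_local : forall x (v : tvec M) (s s' : forall y, L y),
    is_tangent x v -> smooth_near x s -> smooth_near x s' ->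
    (\forall y \near x, s y = s' y) -> conn x v s = conn x v s';
  conn_linear : forall x (c : R) (v w : tvec M) (s : forall y, L y),
    is_tangent x v -> is_tangent x w -> smooth_near x s ->
    conn x (c *: v + w) s = c%:C%C *: conn x v s + conn x w s;
  conn_add : forall x (v : tvec M) (s s' : forall y, L y),
    is_tangent x v -> smooth_near x s -> smooth_near x s' ->
    conn x v (fun y => s y + s' y) = conn x v s + conn x v s';
  conn_leibniz : forall (U : set M) (g : M -> R[i]) (s : forall y, L y),
    open U ->
    smooth_map (matlas M) (vsp_atlas (R * R)%type) U (@c2 R \o g) ->
    smooth_section U s ->
    forall x i (v : tvec M), U x -> chart_dom i x -> is_tangent x v ->
      conn x v (fun y => g y *: s y) =
      r2c (along i v (@c2 R \o g) x) *: s x + g x *: conn x v s;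
  conn_smooth : forall (U : set M) (X : M -> tvec M) (s : forall y, L y),
    open U -> smooth_vfield U X -> smooth_section U s ->
    smooth_section U (fun x => conn x (X x) s) }.

Definition curvature (R : realType) (n : nat) (M : manifold R n)
    (L : line_bundle M) (D : connection L) (X Y : M -> tvec M)
    (s : forall y, L y) (x : M) : L x :=
  D x (X x) (fun y => D y (Y y) s) - D x (Y x) (fun y => D y (X y) s)
  - D x (lie X Y x) s.

Definition twopii (R : realType) : R[i] := (2 * pi)%:C%C * 'i%C.

Record prequantum (R : realType) (n : nat) (M : manifold R n)
    (w : symplectic_form M) := Prequantum {
  pline :> line_bundle M;
  pherm : hermitian pline;
  pconn : connection pline;
  pcurv : forall (U : set M) (X Y : M -> tvec M) (s : forall y, pline y),
    open U -> smooth_vfield U X -> smooth_vfield U Y -> smooth_section U s ->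
    forall x, U x ->
      curvature pconn X Y s x = (- twopii R * (w x (X x) (Y x))%:C%C) *: s x }.

(* The horizontal lift at p of a tangent vector v at pi(p): the horizontal
   vectors are the ds(v) with s a local section through p and D_v s = 0. *)
Definition is_hlift (R : realType) (n : nat) (M : manifold R n)
    (L : line_bundle M) (D : connection L) (p : tot L) (v : tvec M)
    (xi : chart_idx (tot_atlas L) -> ('rV[R]_n * (R * R))%type) : Prop :=
  exists s : forall y, L y,
    [/\ smooth_near (base p) s, s (base p) = vec p, D (base p) v s = 0 &
        is_pushforward (a := matlas M) (b := tot_atlas L)
          (fun y => Tot L y (s y)) (base p) v xi].

Definition expi (R : realType) (r : R) : R[i] := (cos r +i* sin r)%C.

Definition act (R : realType) (n : nat) (M : manifold R n)
  (L : line_bundle M) (p : tot L) (z : R[i]) : tot L :=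
  Tot L (base p) (z *: vec p).

(* w is the value at p of the vertical vector field W_f. *)
Definition is_W (R : realType) (n : nat) (M : manifold R n)
    (L : line_bundle M) (f : M -> R) (p : tot L)
    (w : chart_idx (tot_atlas L) -> ('rV[R]_n * (R * R))%type) : Prop :=
  is_velocity (a := tot_atlas L) setT
    (fun t => act p (expi (2 * pi * t * f (base p)))) 0 w.

Definition hamiltonian_isotopy (R : realType) (n : nat) (M : manifold R n)
    (w : symplectic_form M) (f : R -> M -> R) (X : R -> M -> tvec M)
    (psi psi' : R -> M -> M) : Prop :=
  [/\ smooth_map (cyl_atlas (matlas M)) (vsp_atlas R)
        (unitI (R := R) `*` setT) (fun p => f p.1 p.2),
      isotopy (matlas M) setT psi psi',
      forall t x, unitI t -> is_tangent x (X t x),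
      forall t x i (v : tvec M), unitI t -> chart_dom i x -> is_tangent x v ->
        w x (X t x) v = - along i v (f t) x &
      forall t x, unitI t ->
        is_velocity (a := matlas M) (unitI (R := R)) (psi^~ x) t
          (X t (psi t x))].

Definition is_lift (R : realType) (n : nat) (M : manifold R n)
    (L : line_bundle M) (D : connection L) (f : R -> M -> R)
    (X : R -> M -> tvec M) (F F' : R -> tot L -> tot L) : Prop :=
  isotopy (tot_atlas L) (Lx L) F F' /\
  exists Xsharp W : R -> tot L ->
      chart_idx (tot_atlas L) -> ('rV[R]_n * (R * R))%type,
    [/\ forall t p, unitI t -> Lx L p ->
          is_hlift D p (X t (base p)) (Xsharp t p),
        forall t p, unitI t -> Lx L p -> is_W (f t) p (W t p) &
        forall t p, unitI t -> Lx L p ->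
          is_velocity (a := tot_atlas L) (unitI (R := R)) (F^~ p) t
            (Xsharp t (F t p) - W t (F t p))].

(* The map g : M -> L read as a section: its value at x is the vector g x when
   g x lies over x (and a dummy otherwise). *)
Definition section_of (R : realType) (n : nat) (M : manifold R n)
    (L : line_bundle M) (g : M -> tot L) (x : M) : L x :=
  match pselect (base (g x) = x) with
  | left e => eq_rect (base (g x)) (fun y => L y) (vec (g x)) x e
  | right _ => 0
  end.

Definition transport (R : realType) (n : nat) (M : manifold R n)
    (L : line_bundle M) (F : R -> tot L -> tot L) (psi' : R -> M -> M)
    (tau : forall x, L x) (t : R) : M -> tot L :=
  fun x => F t (Tot L (psi' t x) (tau (psi' t x))).

(* The derivative at t, relative to A, of a curve in the fibre over x; it is
   read in a trivialisation, a linear isomorphism with C. *)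
Definition is_fib_deriv (R : realType) (n : nat) (M : manifold R n)
    (L : line_bundle M) (x : M) (A : set R) (c : R -> L x) (t : R) (l : L x)
    : Prop :=
  forall j, triv_dom j x ->
    has_deriv_within A (fun s => c2 (triv j (c s))) t (c2 (triv j l)).

(* sigma is a smooth family of sections of L, sigma t being defined on
   psi t (U), that solves the initial value problem. *)
Definition is_solution (R : realType) (n : nat) (M : manifold R n)
    (L : line_bundle M) (D : connection L) (f : R -> M -> R)
    (X : R -> M -> tvec M) (psi : R -> M -> M) (U : set M)
    (tau : forall x, L x) (sigma : R -> forall x, L x) : Prop :=
  [/\ smooth_map (cyl_atlas (matlas M)) (tot_atlas L)
        [set p : R * M | unitI p.1 /\ (psi p.1 @` U) p.2]
        (fun p => Tot L p.2 (sigma p.1 p.2)),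
      forall t x, unitI t -> (psi t @` U) x ->
        is_fib_deriv (unitI (R := R)) (fun s => sigma s x) t
          (- D x (X t x) (sigma t) - (twopii R * (f t x)%:C%C) *: sigma t x) &
      forall x, U x -> sigma 0 x = tau x].

(* Main.v *)
From HB Require Import structures.
From mathcomp Require Import ring lra.
Require Import Defs.
Set Implicit Arguments.
Unset Strict Implicit.
Unset Printing Implicit Defensive.
Local Open Scope classical_set_scope.
Local Open Scope ring_scope.

(** Why the theorem holds.  Fix y in U and follow the point psi_s(y).  For a
    smooth family of sections sigma_s, read in a trivialisation, the chain rule
    splits the derivative of s |-> sigma_s(psi_s(y)) into the partial derivative
    of sigma in s and the derivative of sigma_s along X_s.  In the trivialisation
    the latter is D_{X_s} sigma_s - kappa sigma_s, where kappa is the connection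
    form evaluated at X_s.  Hence the equation of the theorem at the point
    psi_s(y) is equivalent to the scalar linear equation

      d/ds sigma_s(psi_s(y)) = - (kappa + 2 pi i f_s) sigma_s(psi_s(y))     (E)

    (fib_deriv_total).  Both assertions follow from it.

    Existence.  In the same trivialisation the vector X^sharp - W_f at a point
    with fibre coordinate b has fibre component - (kappa + 2 pi i f) b
    (hlift_components, vertical_components, lift_velocity).  So the curve
    s |-> F_s(tau(y)) solves (E); it lies over psi_s(y) (lift_base), and it is
    s |-> tau_s(psi_s(y)) by definition of tau_s (transport_flow).  The family
    tau_s is smooth as a composition of smooth maps (transport_smooth).

    Uniqueness.  Two solutions of the scalar equation (E), one of which does not
    vanish, have a quotient with zero derivative (deriv_within_ratio); on [0,1]
    this quotient is constant, so solutions with the same initial value are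
    equal (linear_families_eq, solution_unique).

    That F_s covers psi_s comes from the flow itself: if c is an integral curve
    of X_s then psi_s^-1(c(s)) has zero derivative, because differentiating
    psi_r^-1(psi_r(z)) = z in r computes the very same derivative (flow_unique).

    Smoothness of a map between atlases is only witnessed in some charts, with
    an extension to an open set of the model space.  The work on atlases below
    shows that this may be read in any charts (smooth_map_at), and hence composes
    (smooth_map_comp); it rests on the chain rule for C^k maps (Ck_on_comp). *)

(** * Maps of class C^k *)

Section Ck.
Context {R : realType}.
Implicit Types E F G W : normedModType R.

Lemma differentiable_near_eq E F (f g : E -> F) x :
  (\forall y \near x, f y = g y) -> differentiable f x -> differentiable g x.
Proof.
move=> fg df; apply/diff_locallyP.
have e : g \o shift x = cst (g x) + 'd f x +o_0 id.
  apply/eqaddoP => eps eps0.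
  have [_ /eqaddoP/(_ eps eps0) H] := (@diff_locallyP _ _ _ x f).1 df.
  have fg0 : \forall h \near (0 : E), f (h + x) = g (h + x).
    by have := fg; rewrite (near_shift 0) /=; apply: filterS => z /=;
       rewrite subr0.
  near=> h.
  have -> : (g \o shift x - (cst (g x) + 'd f x)) h =
           (f \o shift x - (cst (f x) + 'd f x)) h.
    rewrite /GRing.add /GRing.opp /=.
    have <- : f (h + x) = g (h + x) by near: h.
    by rewrite (nbhs_singleton fg).
  near: h; exact: H.
have dfc : continuous ('d f x) by apply: diff_continuous.
have -> : 'd g x = 'd f x :> (E -> F) by apply: diff_unique.
by split.
Unshelve. all: by end_near. Qed.

(** Openness of O matters: the derivatives of f and g at a point of O depend on
    their values in a neighbourhood. *)
Lemma Ck_on_eq E F k (O : set E) (f g : E -> F) : open O ->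
  (forall x, O x -> f x = g x) -> Ck_on k O f -> Ck_on k O g.
Proof.
move=> oO; elim: k f g => [|k IH] f g fg /=.
all: have nx x : O x -> \forall y \near x, f y = g y
  by move=> Ox; apply: filterS (open_nbhs_nbhs (conj oO Ox)).
  move=> fc x Ox.
  suff : g @ x --> f x by rewrite fg.
  by apply: cvg_trans (fc _ Ox); apply: near_eq_cvg; exact: nx.
move=> [df dfk]; split=> [x Ox|v].
  exact: differentiable_near_eq (nx _ Ox) (df _ Ox).
apply: IH (dfk v) => // x Ox.
by apply: near_eq_derive; exact: nx.
Qed.

Lemma Ck_onS E F k (O : set E) (f : E -> F) :
  Ck_on k.+1 O f -> Ck_on k O f.
Proof.
elim: k f => [|k IH] f [df dfk] /=.
  by move=> x Ox; exact/differentiable_continuous/df.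
by split=> // v; apply: IH.
Qed.

Lemma Ck_on_sub E F k (O O' : set E) (f : E -> F) : O' `<=` O ->
  Ck_on k O f -> Ck_on k O' f.
Proof.
move=> OO; elim: k f => [|k IH] f /= => [fc x /OO|[df dfk]]; first exact: fc.
by split=> [x /OO|v]; [exact: df|exact: IH].
Qed.

Lemma Ck_on_cst E F k (O : set E) (a : F) : Ck_on k O (fun=> a).
Proof.
elim: k a => [|k IH] a /=; first by move=> x _; exact: cvg_cst.
split=> [x _|v]; first exact: differentiable_cst.
by under eq_fun do rewrite derive_cst.
Qed.

(** Pairing, sums and coordinates are all compositions with continuous linear
    maps, so this is the basic closure property. *)
Lemma Ck_on_lin E F G k (O : set E) (f : E -> F) (l : {linear F -> G}) :
  open O -> continuous l -> Ck_on k O f -> Ck_on k O (l \o f).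
Proof.
move=> oO lc; elim: k f => [|k IH] f /=.
  by move=> fc x Ox; apply: continuous_comp; [exact: fc|exact: lc].
move=> [df dfk]; split=> [x Ox|v].
  by apply: differentiable_comp; [exact: df|exact: linear_differentiable].
apply: Ck_on_eq (IH _ (dfk v)) => // x Ox /=.
have ? := df _ Ox; have ? := @linear_differentiable _ _ _ _ (f x) lc.
rewrite [RHS]deriveE; last exact: differentiable_comp.
by rewrite diff_comp //= diff_lin // deriveE.
Qed.

Lemma Ck_on_add E F k (O : set E) (f g : E -> F) : open O ->
  Ck_on k O f -> Ck_on k O g -> Ck_on k O (f \+ g).
Proof.
move=> oO; elim: k f g => [|k IH] f g /=.
  by move=> fc gc x Ox; apply: cvgD; [exact: fc|exact: gc].
move=> [df dfk] [dg dgk]; split=> [x Ox|v].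
  by apply: differentiableD; [exact: df|exact: dg].
apply: Ck_on_eq (IH _ _ (dfk v) (dgk v)) => // x Ox /=.
by rewrite deriveD //; apply: diff_derivable; [exact: df|exact: dg].
Qed.

Lemma Ck_on_sum E F k (O : set E) m (f : 'I_m -> E -> F) : open O ->
  (forall i, Ck_on k O (f i)) -> Ck_on k O (fun x => \sum_i f i x).
Proof.
move=> oO; elim: m f => [|m IH] f fk.
  by under eq_fun do rewrite big_ord0; exact: Ck_on_cst.
under eq_fun do rewrite big_ord_recl.
by apply: Ck_on_add => //; apply: IH => i.
Qed.

Section scale.
Variable W : normedModType R.
(** Scaling, named so that it can carry a bilinear structure and be
    differentiated as a bilinear map. *)
Let sc (a : R) (u : W) := a *: u.

Let sc_is_bilinear : bilinear_for
    (GRing.Scale.Law.clone _ _ *:%R _) (GRing.Scale.Law.clone _ _ *:%R _) sc.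
Proof.
split=> [u'|u] a x y /=; first by rewrite /sc scalerDl scalerA.
by rewrite /sc scalerDr !scalerA mulrC.
Qed.
HB.instance Definition _ :=
  bilinear_isBilinear.Build R R W W _ _ sc sc_is_bilinear.

Let sc_cont : continuous (fun p : R * W => sc p.1 p.2).
Proof. exact: scale_continuous. Qed.

Lemma differentiable_scale E (f : E -> R) (g : E -> W) x :
  differentiable f x -> differentiable g x ->
  differentiable (fun y => f y *: g y) x /\
  forall v, 'D_v (fun y => f y *: g y) x = 'D_v f x *: g x + f x *: 'D_v g x.
Proof.
move=> df dg.
have -> : (fun y => f y *: g y) =
  (fun p : R * W => sc p.1 p.2) \o (fun y => (f y, g y)) by [].
have dp := differentiable_pair df dg.
have ds : differentiable (fun p : R * W => sc p.1 p.2) (f x, g x)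
  by apply: differentiable_bilin.
have dc := differentiable_comp dp ds.
split=> // v; rewrite !deriveE // diff_comp //= diff_bilin //= diff_pair //=.
by rewrite /sc addrC.
Qed.
End scale.

Lemma Ck_on_scale E W k (O : set E) (f : E -> R) (g : E -> W) : open O ->
  Ck_on k O f -> Ck_on k O g -> Ck_on k O (fun x => f x *: g x).
Proof.
move=> oO; elim: k f g => [|k IH] f g fk gk.
  by move=> x Ox; apply: cvgZ; [exact: fk|exact: gk].
have [[df dfk] [dg dgk]] := (fk, gk); split=> [x Ox|v].
  by have [] := differentiable_scale (df _ Ox) (dg _ Ox).
apply: (@Ck_on_eq _ _ _ _
  ((fun x => 'D_v f x *: g x) \+ (fun x => f x *: 'D_v g x))) => //.
  by move=> x Ox /=; have [_ ->] := differentiable_scale (df _ Ox) (dg _ Ox).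
apply: Ck_on_add => //; apply: IH; 
  [exact: dfk|exact: Ck_onS|exact: Ck_onS|exact: dgk].
Qed.

(** A basis with continuous coordinates.  The model spaces are products of R and
    row vectors, and this form is stable under products. *)
Definition findim F := exists m (e : 'I_m -> F) (c : 'I_m -> {linear F -> R}),
  (forall i, continuous (c i)) /\ forall v, v = \sum_i c i v *: e i.

(** The chain rule at order k.  The intermediate space has to be
    finite-dimensional because C^k is defined through directional derivatives in
    fixed directions. *)
Lemma Ck_on_comp E F G k (O : set E) (O' : set F) (f : E -> F) (g : F -> G) :
  findim F -> open O -> (forall x, O x -> O' (f x)) ->
  Ck_on k O f -> Ck_on k O' g -> Ck_on k O (g \o f).
Proof.
move=> [m [e [c [cc ce]]]] oO fO; elim: k f g fO => [|k IH] f g fO fk gk.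
  move=> x Ox; apply: continuous_comp; [exact: fk|exact/gk/fO].
have [[df dfk] [dg dgk]] := (fk, gk); split=> [x Ox|v].
  by apply: differentiable_comp; [exact: df|exact/dg/fO].
(* The differential of g is expanded on the basis e, so that the derivative of
   g \o f only involves directional derivatives of g in fixed directions. *)
apply: (@Ck_on_eq _ _ _ _ (fun x =>
    \sum_i (c i \o (fun x => 'D_v f x)) x *: ((fun y => 'D_(e i) g y) \o f) x)).
- by [].
- move=> x Ox; have ? := df _ Ox; have ? := dg _ (fO _ Ox).
  rewrite [RHS]deriveE; last exact: differentiable_comp.
  rewrite diff_comp //= [in RHS](ce ('d f x v)) linear_sum /=.
  by apply: eq_bigr => i _; rewrite linearZ /= !deriveE.
apply: Ck_on_sum => // i; apply: Ck_on_scale => //.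
  exact: (Ck_on_lin oO (cc i) (dfk v)).
by apply: IH; [exact: fO|exact: Ck_onS|exact: dgk].
Qed.

End Ck.

Section finite_dimension.
Context {R : realType}.
Implicit Types E F G W : normedModType R.

Section inj.
Variables E F : normedModType R.
Let inl_ (x : E) : (E * F)%type := (x, 0).
Let inr_ (y : F) : (E * F)%type := (0, y).
Let inl_lin : linear inl_.
Proof.
by move=> a x y; apply/pair_eqP/andP; split; apply/eqP;
   rewrite /= ?scaler0 ?addr0.
Qed.
Let inr_lin : linear inr_.
Proof.
by move=> a x y; apply/pair_eqP/andP; split; apply/eqP;
   rewrite /= ?scaler0 ?addr0.
Qed.
HB.instance Definition _ := GRing.isLinear.Build R E (E * F)%type _ inl_ inl_lin.
HB.instance Definition _ := GRing.isLinear.Build R F (E * F)%type _ inr_ inr_lin.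

Lemma Ck_on_pair G k (O : set G) (f : G -> E) (g : G -> F) : open O ->
  Ck_on k O f -> Ck_on k O g -> Ck_on k O (fun x => (f x, g x)).
Proof.
move=> oO fk gk.
have ->: (fun x => (f x, g x)) = (inl_ \o f) \+ (inr_ \o g).
  by apply/funext => x /=; apply/pair_eqP/andP; split; apply/eqP;
     rewrite /= ?add0r ?addr0.
by apply: Ck_on_add => //; apply: Ck_on_lin => // x; apply: cvg_pair => //;
  exact: cvg_cst.
Qed.
End inj.

Lemma findim_R : findim R.
Proof.
exists 1%N, (fun=> 1), (fun=> idfun); split=> [i x|v]; first exact.
by rewrite big_ord_recl big_ord0 addr0 /= /GRing.scale /= mulr1.
Qed.

Lemma findim_pair E F : findim E -> findim F -> findim (E * F)%type.
Proof.
move=> [m [e [c [cc ce]]]] [m' [e' [c' [cc' ce']]]].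
pose d (i : 'I_(m + m')) : (E * F)%type :=
  match fintype.split i with inl j => (e j, 0) | inr j => (0, e' j) end.
pose b (i : 'I_(m + m')) : {linear (E * F)%type -> R} :=
  match fintype.split i with inl j => c j \o fst | inr j => c' j \o snd end.
exists (m + m')%N, d, b; rewrite /d /b {d b}.
split=> [i|[u v]].
  case: (fintype.split i) => j x; apply: continuous_comp; [|exact: cc| |exact: cc'].
    exact: cvg_fst.
  exact: cvg_snd.
rewrite big_split_ord /=.
under eq_bigr => i _ do rewrite (unsplitK (inl i)) /=.
under [X in _ + X]eq_bigr => i _ do rewrite (unsplitK (inr i)) /=.
apply/pair_eqP/andP; split; apply/eqP => /=.
  rewrite !raddf_sum /= [X in _ + X]big1 ?addr0 => [|i _]; last by rewrite scaler0.
  exact: ce.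
rewrite !raddf_sum /= [X in X + _]big1 ?add0r => [|i _]; last by rewrite scaler0.
exact: ce'.
Qed.

Section coord.
Variables (n : nat) (i : 'I_n).
Let co (v : 'rV[R]_n) : R := v ord0 i.
Let co_lin : linear co.
Proof. by move=> a x y; rewrite /co !mxE. Qed.
HB.instance Definition _ := GRing.isLinear.Build R 'rV[R]_n R _ co co_lin.
Definition rv_coord : {linear 'rV[R]_n -> R} := co.
Lemma rv_coord_cont : continuous rv_coord.
Proof. by move=> x; exact: coord_continuous. Qed.
End coord.

Lemma findim_rV n : findim 'rV[R]_n.
Proof.
exists n, (fun i => delta_mx ord0 i), (@rv_coord n); split.
  exact: rv_coord_cont.
by move=> v; rewrite [LHS]row_sum_delta.
Qed.

End finite_dimension.

(** * Derivatives of curves relative to a set of times *)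

Section within_derivative.
Context {R : realType}.
Implicit Types (E F : normedModType R) (A : set R) (t : R).

Lemma cvg_near_eq (T : Type) (F : normedModType R) (Phi : set_system T)
    {FPhi : Filter Phi} (f g : T -> F) (l : F) :
  (\forall x \near Phi, f x = g x) -> f @ Phi --> l -> g @ Phi --> l.
Proof.
move=> fg fl B /fl fB; rewrite /nbhs /= /fmap.
by apply: filterS2 fg fB => x /= <-.
Qed.

Lemma within_dnbhs_cvg A t : within A t^' --> t.
Proof.
move=> B Bt; have : nbhs t^' B by exact: cvg_within.
by apply: filterS => s Bs _.
Qed.

Lemma within_dnbhs_neq A t : \forall s \near within A t^', s != t.
Proof.
rewrite near_withinE; apply: filterS (nbhs_dnbhs_neq t) => s st _; exact: st.
Qed.

Lemma deriv_within_cvg F A (c : R -> F) t v :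
  has_deriv_within A c t v -> c @ within A t^' --> c t.
Proof.
move=> cv.
have st : (fun s : R => s - t) @ within A t^' --> (0 : R).
  rewrite -[X in _ --> X](subrr t); apply: (@cvgB R R); last exact: cvg_cst.
  exact: within_dnbhs_cvg.
have cvH : (fun s => (s - t) *: ((s - t)^-1 *: (c s - c t)) + c t)
    @ within A t^' --> 0 *: v + c t.
  by apply: cvgD; [exact: cvgZ|exact: cvg_cst].
rewrite scale0r add0r in cvH; apply: (cvg_near_eq _ cvH) => {cvH}.
near=> s => /=.
have st0 : s != t by near: s; exact: within_dnbhs_neq.
by rewrite scalerA mulfV ?subr_eq0// scale1r subrK.
Unshelve. all: by end_near. Qed.

(** The chain rule when the curve is only differentiable relative to A, while
    the map g is differentiable in the full sense at c t. *)
Lemma deriv_within_comp E F A (c : R -> E) (g : E -> F) t v :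
  has_deriv_within A c t v -> differentiable g (c t) ->
  has_deriv_within A (g \o c) t ('d g (c t) v).
Proof.
move=> cv dg; have ct := deriv_within_cvg cv.
have [dgc /eqaddoP gE] := (@diff_locallyP _ _ _ (c t) g).1 dg.
set r := (_ - _) in gE.
have rE h : g (h + c t) = g (c t) + 'd g (c t) h + r h.
  by rewrite [RHS]addrC -[r h]/(g (h + c t) - (g (c t) + 'd g (c t) h)) subrK.
have q1 : (fun s => 'd g (c t) ((s - t)^-1 *: (c s - c t))) @ within A t^'
    --> 'd g (c t) v.
  by apply: continuous_cvg => //; exact: dgc.
suff q2 : (fun s => (s - t)^-1 *: r (c s - c t)) @ within A t^' --> (0 : F).
  have cvH : (fun s => 'd g (c t) ((s - t)^-1 *: (c s - c t)) +
      (s - t)^-1 *: r (c s - c t)) @ within A t^' --> 'd g (c t) v + 0.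
    by apply: cvgD.
  rewrite addr0 in cvH; apply: (cvg_near_eq _ cvH) => {cvH}.
  apply: nearW => s /=.
  have -> : g (c s) = g (c t) + 'd g (c t) (c s - c t) + r (c s - c t).
    by rewrite -rE subrK.
  rewrite linearZ /= -scalerDr [X in _ = _ *: X]addrC.
  by rewrite -[g (c t) + _ + _]addrA addKr.
apply/cvgr0Pnorm_lt => e e0.
have K0 : 0 < `|v| + 1 by rewrite ltr_wpDl.
have := gE (e / (`|v| + 1) / 2) ltac:(by rewrite !divr_gt0).
have c0 : (fun s => c s - c t) @ within A t^' --> (0 : E).
  by rewrite -(subrr (c t)); apply: cvgB => //; exact: cvg_cst.
move=> /c0 /= H.
have B : \forall s \near within A t^', `|(s - t)^-1 *: (c s - c t)| < `|v| + 1.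
  by apply: cvgr_norm_lt cv _ _; rewrite ltrDl.
near=> s.
have Bs : `|(s - t)^-1 *: (c s - c t)| < `|v| + 1 by near: s.
have Hs : `|r (c s - c t)| <= e / (`|v| + 1) / 2 * `|c s - c t| by near: s.
rewrite normrZ; apply: le_lt_trans (ler_wpM2l (normr_ge0 _) Hs) _.
rewrite mulrCA -normrZ -[_ / 2 * _]mulrA.
apply: (@le_lt_trans _ _ (e / (`|v| + 1) * (2^-1 * (`|v| + 1)))).
     by rewrite ler_pM2l ?divr_gt0// ler_pM2l// ltW.
by rewrite mulrCA mulfVK ?gt_eqF// gtr_pMl// invf_lt1// ltr1n.
Unshelve. all: by end_near. Qed.

Lemma deriv_within_lin E F A (c : R -> E) (l : {linear E -> F}) t v :
  continuous l -> has_deriv_within A c t v ->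
  has_deriv_within A (l \o c) t (l v).
Proof.
move=> lc cv; have dl : differentiable (l : E -> F) (c t).
  exact: linear_differentiable.
by have := deriv_within_comp cv dl; rewrite diff_lin.
Qed.

Lemma deriv_within_pair E F A (c : R -> E) (d : R -> F) t v w :
  has_deriv_within A c t v -> has_deriv_within A d t w ->
  has_deriv_within A (fun s => (c s, d s)) t (v, w).
Proof. by move=> cv dw; exact: cvg_pair cv dw. Qed.

Lemma deriv_within_id A t : has_deriv_within A id t (1 : R).
Proof.
apply: cvg_near_eq (cvg_cst (1 : R)); near=> s.
have st0 : s != t by near: s; exact: within_dnbhs_neq.
by rewrite /= /GRing.scale /= mulVf// subr_eq0.
Unshelve. all: by end_near. Qed.

Lemma deriv_within_cst F A (a : F) t : has_deriv_within A (fun=> a) t 0.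
Proof.
rewrite /has_deriv_within; under eq_fun do rewrite subrr scaler0.
exact: cvg_cst.
Qed.

Lemma deriv_within_eq F A (c d : R -> F) t v :
  c t = d t -> (\forall s \near within A (nbhs t), c s = d s) ->
  has_deriv_within A c t v -> has_deriv_within A d t v.
Proof.
move=> ctd cd => cvH; apply: (cvg_near_eq _ cvH) => {cvH}.
have cd' : \forall s \near within A t^', c s = d s.
  move: cd; rewrite !near_withinE; exact: cvg_within.
by apply: filterS cd' => s /= ->; rewrite ctd.
Qed.

Lemma deriv_within_continuous F A (c : R -> F) t v :
  has_deriv_within A c t v -> c @ within A (nbhs t) --> c t.
Proof.
move=> /deriv_within_cvg ct B Bct.
have H0 : \forall s \near t, s != t -> A s -> B (c s) := ct _ Bct.
suff : \forall s \near t, A s -> B (c s) by [].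
 apply: filterS H0 => s H As; have [->|st] := eqVneq s t.
  exact: nbhs_singleton.
exact: H.
Qed.

Lemma within_unitI_proper t : unitI t -> ProperFilter (within (@unitI R) t^').
Proof.
move=> tI; apply: Build_ProperFilter_ex => P.
rewrite /within /= /dnbhs /within /= => /nbhs_ballP[e /= e0 eP].
move: tI => /andP[t0 t1].
(* A step smaller than 1/2 stays in [0,1] when it goes towards the middle. *)
have [d [d0 de d1]] : exists d : R, [/\ 0 < d, d < e & d < 2^-1].
  have me : Order.min e 2^-1 <= e by rewrite ge_min lexx.
  have m2 : Order.min e 2^-1 <= 2^-1 by rewrite ge_min lexx orbT.
  have m0 : 0 < Order.min e 2^-1 by rewrite lt_min e0 invr_gt0 ltr0n.
  by exists (Order.min e 2^-1 / 2); split; lra.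
have [th|th] := lerP t 2^-1.
  exists (t + d); apply: eP.
  - by rewrite /ball /= opprD addrA subrr add0r normrN gtr0_norm.
  - by rewrite -subr_eq0 addrAC subrr add0r gt_eqF.
  - by apply/andP; split; lra.
exists (t - d); apply: eP.
- by rewrite /ball /= opprB addrC subrK gtr0_norm.
- by rewrite -subr_eq0 addrAC subrr add0r oppr_eq0 gt_eqF.
- by apply/andP; split; lra.
Qed.

(** Every point of [0,1] is an accumulation point of [0,1], also the end
    points. *)
Lemma deriv_within_unique F (c : R -> F) t v w : unitI t ->
  has_deriv_within (@unitI R) c t v -> has_deriv_within (@unitI R) c t w ->
  v = w.
Proof.
move=> /within_unitI_proper PF cv cw.
exact: (cvg_unique (@norm_hausdorff R F) cv cw).
Qed.

(** The mean value theorem; the end points of [0,1] only matter for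
    continuity, since a point strictly between a and b is interior. *)
Lemma deriv_within0_itv (phi : R -> R) a b : a < b ->
  (forall s, a <= s <= b -> unitI s) ->
  (forall s, a <= s <= b -> has_deriv_within (@unitI R) phi s 0) ->
  phi a = phi b.
Proof.
move=> ab abI d0.
have [c _] : exists2 c, c \in `]a, b[%R & phi b - phi a = 0 * (b - a).
  apply: (@MVT R phi (fun=> 0)) => //.
    move=> x; rewrite in_itv /= => /andP[ax xb].
    have := d0 x; rewrite !ltW// => /(_ isT) dx.
    suff H : (fun h => h^-1 *: (phi (h *: 1 + x) - phi x)) @ 0^' --> (0 : R).
      by split; [apply/cvg_ex; exists 0|exact: cvg_lim].
    move=> B /dx HB0.
    have HB : \forall s \near x, s != x -> unitI s ->
      B ((s - x)^-1 *: (phi s - phi x)) := HB0.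
    suff : \forall h \near (0 : R), h != 0 ->
      B (h^-1 *: (phi (h *: 1 + x) - phi x)) by [].
    have abx : \forall s \near x, a <= s <= b.
      near=> s; apply/andP; split; apply/ltW; near: s.
        exact: lt_nbhsr.
      exact: lt_nbhsl.
    have : \forall s \near x, s != x -> B ((s - x)^-1 *: (phi s - phi x)).
      by apply: filterS2 HB abx => s H /abI sI sx; exact: H.
    rewrite (near_shift 0) /= subr0 => H0; apply: filterS H0 => h /= H h0.
    have := H; rewrite addrK -subr_eq0 addrK => /(_ h0).
    by rewrite /(h *: 1) /GRing.scale /= mulr1.
  apply/subspace_continuousP => x; rewrite /= in_itv /= => xab.
  have := deriv_within_continuous (d0 _ xab).
  apply: cvg_trans; apply: cvg_app; apply: within_subset => s /=.
  by rewrite in_itv /=; exact: abI.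
by rewrite mul0r => /eqP; rewrite subr_eq0 => /eqP.
Unshelve. all: by end_near. Qed.

Lemma deriv_within0_near F (c : R -> F) t : findim F -> unitI t ->
  (\forall s \near within (@unitI R) (nbhs t),
     has_deriv_within (@unitI R) c s 0) ->
  \forall s \near within (@unitI R) (nbhs t), c s = c t.
Proof.
move=> [m [e [co [coc coe]]]] tI.
rewrite !near_withinE => /nbhs_ballP[r /= r0 H].
apply/nbhs_ballP; exists r => // s sr sI.
rewrite (coe (c s)) (coe (c t)); apply: eq_bigr => i _; congr (_ *: _).
have K u : ball t r u -> unitI u ->
    has_deriv_within (@unitI R) (co i \o c) u 0.
  move=> ur uI; rewrite -(linear0 (co i)).
  by apply: deriv_within_lin => //; exact: H.
have tr : ball t r t by exact: ballxx.
have conv a b u : ball t r a -> ball t r b -> unitI a -> unitI b ->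
    a <= u <= b -> ball t r u /\ unitI u.
  rewrite /ball /= !ltr_distlC /unitI /= => /andP[? ?] /andP[? ?] /andP[? ?].
  move=> /andP[? ?] /andP[? ?].
  by split; apply/andP; split; lra.
case: (ltgtP s t) => [st|ts|-> //].
  apply: (@deriv_within0_itv (co i \o c)) => // u /(conv _ _ _ sr tr sI tI) [] //.
  by apply: K.
apply/esym/(@deriv_within0_itv (co i \o c)) => // u /(conv _ _ _ tr sr tI sI) [] //.
by apply: K.
Qed.

(** Connectedness of [0,1] as an induction principle: a property that locally
    does not change propagates from 0. *)
Lemma unitI_ind (P : R -> Prop) :
  (forall t, unitI t ->
     \forall s \near within (@unitI R) (nbhs t), P s <-> P t) ->
  P 0 -> forall t, unitI t -> P t.
Proof.
move=> loc P0 t tI.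
pose B := [set s | unitI s /\ P s].
have cI : connected (@unitI R).
  have -> : @unitI R = `[0, 1]%classic.
    by apply/seteqP; split => s /=; rewrite in_itv.
  exact: segment_connected.
have opn (Q : R -> Prop) : (forall t, unitI t ->
     \forall s \near within (@unitI R) (nbhs t), Q s <-> Q t) ->
   exists2 C : set R, open C & [set s | unitI s /\ Q s] = @unitI R `&` C.
  move=> Qloc; exists (interior [set s | unitI s -> Q s]).
    exact: open_interior.
  apply/seteqP; split=> s /=.
    move=> [sI Qs]; split=> //; rewrite /interior.
    have := Qloc _ sI; rewrite near_withinE => H0.
    by apply: filterS H0 => u /= H /H Hu; exact/Hu.
  by move=> [sI /nbhs_singleton /(_ sI)].
suff BI : B = @unitI R by have : B t; [rewrite BI|case].
apply: cI.
- by exists 0; split=> //; rewrite /unitI /= lexx ler01.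
- exact: opn.
- have [|C oC CE] := opn (fun s => ~ P s).
    by move=> u uI; apply: filterS (loc _ uI) => s /= ->.
  exists (~` C); first exact: open_closedC.
  apply/seteqP; split => s /=.
    move=> [sI Ps]; split=> // Cs.
    have : [set s | unitI s /\ ~ P s] s by rewrite CE.
    by case.
  move=> [sI Cs]; split=> //; apply: contrapT => nP.
  have : [set s | unitI s /\ ~ P s] s by [].
  by rewrite CE => -[].
Qed.

End within_derivative.

(** * Smooth maps between atlases *)

Section smooth_on.
Context {R : realType}.
Implicit Types E F G : normedModType R.

Lemma smooth_on_id E (O : set E) : smooth_on O id.
Proof.
case=> [|k] /=; first by move=> x _; exact: cvg_id.
split=> [x _|v]; first exact: ex_diff.
under eq_fun do rewrite derive_id.
exact: Ck_on_cst.
Qed.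

Lemma smooth_on_lin E F (O : set E) (l : {linear E -> F}) :
  open O -> continuous l -> smooth_on O l.
Proof. by move=> oO lc k; apply: (Ck_on_lin oO lc (@smooth_on_id E O k)). Qed.

Lemma smooth_on_fst E F (O : set (E * F)%type) : open O -> smooth_on O fst.
Proof. by move=> oO; apply: smooth_on_lin => // x; exact: cvg_fst. Qed.

Lemma smooth_on_snd E F (O : set (E * F)%type) : open O -> smooth_on O snd.
Proof. by move=> oO; apply: smooth_on_lin => // x; exact: cvg_snd. Qed.

Lemma smooth_on_pair E F G (O : set G) (f : G -> E) (g : G -> F) : open O ->
  smooth_on O f -> smooth_on O g -> smooth_on O (fun x => (f x, g x)).
Proof. by move=> oO fs gs k; apply: Ck_on_pair. Qed.

Lemma smooth_on_comp E F G (O : set E) (O' : set F) (f : E -> F) (g : F -> G) :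
  findim F -> open O -> (forall x, O x -> O' (f x)) ->
  smooth_on O f -> smooth_on O' g -> smooth_on O (g \o f).
Proof. by move=> dF oO fO fs gs k; exact: Ck_on_comp dF oO fO (fs k) (gs k). Qed.

Lemma smooth_on_sub E F (O O' : set E) (f : E -> F) : O' `<=` O ->
  smooth_on O f -> smooth_on O' f.
Proof. by move=> OO fs k; exact: Ck_on_sub OO (fs k). Qed.

Lemma smooth_on_cst E F (O : set E) (a : F) : smooth_on O (fun=> a).
Proof. by move=> k; exact: Ck_on_cst. Qed.

Lemma smooth_on_continuous E F (O : set E) (f : E -> F) x :
  smooth_on O f -> O x -> {for x, continuous f}.
Proof. by move=> /(_ 0%N); apply. Qed.

Lemma smooth_on_differentiable E F (O : set E) (f : E -> F) x :
  smooth_on O f -> O x -> differentiable f x.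
Proof. by move=> /(_ 1%N)[+ _]; apply. Qed.

Lemma open_smooth_preimage E F (O : set E) (O' : set F) (f : E -> F) :
  open O -> open O' -> smooth_on O f -> open (O `&` f @^-1` O').
Proof.
rewrite !openE => oO oO' fs x [Ox O'x].
apply: filterI; first exact: oO.
by apply: (smooth_on_continuous fs Ox); exact: oO'.
Qed.

End smooth_on.

Section smooth_maps.
Context {R : realType}.
Implicit Types E F G : normedModType R.

(** The local condition in smooth_map, with the charts i and k prescribed rather
    than existentially quantified. *)
Definition smooth_at E F (T T' : Type) (a : atlas E T) (b : atlas F T')
    (S : set T) (f : T -> T') (i : chart_idx a) (k : chart_idx b) (p : T) :=
  exists (O : set E) (g : E -> F),
    [/\ open O, O (chart_map i p), smooth_on O g &
        forall q, S q -> chart_dom i q -> O (chart_map i q) ->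
          chart_dom k (f q) /\ chart_map k (f q) = g (chart_map i q)].

Arguments smooth_at {E F T T'} a b S f i k p.

(** All transition maps are smooth; stated through the identity, it is the case
    of smooth_at in which only the chart changes. *)
Definition compatible E (T : Type) (a : atlas E T) :=
  forall (i j : chart_idx a) p, chart_dom i p -> chart_dom j p ->
    smooth_at a a setT id i j p.

Lemma smooth_at_comp E F G (T T' T'' : Type) (a : atlas E T) (b : atlas F T')
    (c : atlas G T'') (S : set T) (S' : set T') (f : T -> T') (g : T' -> T'')
    i k l p : findim F ->
  S p -> chart_dom (a := a) i p -> (forall q, S q -> S' (f q)) ->
  smooth_at a b S f i k p -> smooth_at b c S' g k l (f p) ->
  smooth_at a c S (g \o f) i l p.
Proof.
move=> dF Sp ip fS [ O [h [ oO Op hs hE]]] [ O' [h' [ oO' Op' hs' hE']]].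
have [kf fE] := hE _ Sp ip Op.
(* h maps only part of O into the domain of h'. *)
exists (O `&` h @^-1` O'), (h' \o h); split.
- exact: open_smooth_preimage.
- by split => //=; rewrite -fE.
- apply: (@smooth_on_comp _ _ _ _ _ O') => //.
  + exact: open_smooth_preimage.
  + by move=> x [].
  + by apply: smooth_on_sub hs => x [].
- move=> q Sq iq [Oq O'q]; have [kq fqE] := hE _ Sq iq Oq.
  have [|lq gqE] := hE' _ (fS _ Sq) kq; first by rewrite fqE.
  by split=> //=; rewrite gqE fqE.
Qed.

(** Any pair of charts around p and f p can be used: compose with a transition
    map on either side. *)
Lemma smooth_map_at E F (T T' : Type) (a : atlas E T) (b : atlas F T')
    (S : set T) (f : T -> T') i k p : findim E -> findim F ->
  compatible a -> compatible b -> smooth_map a b S f -> S p ->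
  chart_dom i p -> chart_dom k (f p) -> smooth_at a b S f i k p.
Proof.
move=> dE dF ca cb fs Sp ip kp; have [i' [k' [ip' kp' fat]]] := fs _ Sp.
have f1 : smooth_at a b S f i k' p.
  have idS : smooth_at a a S id i i' p.
    have [ O [g [? ? ? gE]]] := ca _ _ _ ip ip'.
    by exists O, g; split=> // q _; exact: gE.
  exact: (smooth_at_comp (S' := S) dE Sp ip _ idS fat).
exact: (smooth_at_comp (S' := setT) dF Sp ip _ f1 (cb _ _ _ kp' kp)).
Qed.

(** The two witnesses may use different charts in the middle, which is why the
    middle atlas has to be compatible. *)
Lemma smooth_map_comp E F G (T T' T'' : Type) (a : atlas E T) (b : atlas F T')
    (c : atlas G T'') (S : set T) (S' : set T') (f : T -> T') (g : T' -> T'') :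
  findim F -> compatible b -> (forall q, S q -> S' (f q)) ->
  smooth_map a b S f -> smooth_map b c S' g -> smooth_map a c S (g \o f).
Proof.
move=> dF cb fS fs gs p Sp.
have [i [k [ip kp fat]]] := fs _ Sp; have [k' [l [kp' lp gat]]] := gs _ (fS _ Sp).
exists i, l; split=> //.
have f1 : smooth_at a b S f i k' p.
  exact: (smooth_at_comp (S' := setT) dF Sp ip _ fat (cb _ _ _ kp kp')).
exact: (smooth_at_comp dF Sp ip fS f1 gat).
Qed.

Lemma smooth_map_sub E F (T T' : Type) (a : atlas E T) (b : atlas F T')
    (S S' : set T) (f : T -> T') : S' `<=` S ->
  smooth_map a b S f -> smooth_map a b S' f.
Proof.
move=> fS fs p /fS /fs[i [k [ip kp [ O [g [ oO Op gs gE]]]]]].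
exists i, k; split=> //; exists O, g; split=> // q /fS; exact: gE.
Qed.

Lemma smooth_map_eq E F (T T' : Type) (a : atlas E T) (b : atlas F T')
    (S : set T) (f f' : T -> T') : (forall p, S p -> f p = f' p) ->
  smooth_map a b S f -> smooth_map a b S f'.
Proof.
move=> ff fs p Sp; have [i [k [ip kp [ O [g [ oO Op gs gE]]]]]] := fs _ Sp.
exists i, k; split=> //; first by rewrite -ff.
exists O, g; split=> // q Sq; rewrite -ff//; exact: gE.
Qed.

Lemma compatible_vsp E : compatible (vsp_atlas E).
Proof.
move=> i j p _ _; exists setT, id; split=> //; first exact: openT.
exact: smooth_on_id.
Qed.

Lemma open_snd E F (O : set F) : open O -> open [set p : E * F | O p.2].
Proof.
move=> oO; apply: (@open_comp _ _ (@snd E F)) => // p _; exact: cvg_snd.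
Qed.

Lemma open_fst E F (O : set E) : open O -> open [set p : E * F | O p.1].
Proof.
move=> oO; apply: (@open_comp _ _ (@fst E F)) => // p _; exact: cvg_fst.
Qed.

Lemma compatible_cyl E (T : Type) (a : atlas E T) : findim E ->
  compatible a -> compatible (cyl_atlas a).
Proof.
move=> dE ca i j p /= ip jp; have [ O [g [ oO Op gs gE]]] := ca _ _ _ ip jp.
have oO' : open [set p : R * E | O p.2] by exact: open_snd.
exists [set p : R * E | O p.2], (fun p => (p.1, g p.2)); split=> //.
  apply: smooth_on_pair => //; first exact: smooth_on_fst.
  exact: (smooth_on_comp (O' := O) dE oO' _ (@smooth_on_snd _ _ _ _ oO')).
by move=> q _ /= iq Oq; have [? ->] := gE q.2 I iq Oq.
Qed.

Lemma smooth_map_cyl E F (T T' : Type) (a : atlas E T) (b : atlas F T') S f :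
  smooth_map (cyl_atlas a) b S f ->
  smooth_map (cyl_atlas a) (cyl_atlas b) S (fun p => (p.1, f p)).
Proof.
move=> fs p Sp; have [i [k [ip kp [ O [g [ oO Op gs gE]]]]]] := fs _ Sp.
exists i, k; split=> //; exists O, (fun p => (p.1, g p)); split=> //.
  by apply: smooth_on_pair => //; exact: smooth_on_fst.
by move=> q Sq iq Oq /=; have [? <-] := gE _ Sq iq Oq.
Qed.

Lemma smooth_map_snd E (T : Type) (a : atlas E T) S :
  (forall x, exists i : chart_idx a, chart_dom i x) ->
  smooth_map (cyl_atlas a) a S snd.
Proof.
move=> cov [s x] Sp; have [i ix] := cov x.
exists i, i; split=> //; exists setT, snd; split=> //; first exact: openT.
by apply: smooth_on_snd; exact: openT.
Qed.

Lemma smooth_map_slice E (T : Type) (a : atlas E T) S (t : R) :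
  (forall x, exists i : chart_idx a, chart_dom i x) ->
  smooth_map a (cyl_atlas a) S (fun x => (t, x)).
Proof.
move=> cov x Sx; have [i ix] := cov x.
exists i, i; split=> //; exists setT, (fun z => (t, z)); split=> //.
  exact: openT.
apply: smooth_on_pair; first exact: openT.
  exact: smooth_on_cst.
exact: smooth_on_id.
Qed.

End smooth_maps.
Arguments smooth_at {R E F T T'} a b S f i k p.

(** * The topology of a manifold *)

Section manifold.
Context {R : realType} {n : nat} (M : manifold R n).
Implicit Types (i : chart_idx (matlas M)) (x : M).

Lemma chart_cover x : exists i, chart_dom i x.
Proof. by have [] := manifoldP M. Qed.

Lemma chart_dom_open i : open (chart_dom i).
Proof. by have [_ _ /(_ i)[] ? ? ? ? ? _] := manifoldP M. Qed.

Lemma chart_invK i x : chart_dom i x -> chart_inv i (chart_map i x) = x.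
Proof. by have [_ _ /(_ i)[_ _ + _ _] _] := manifoldP M; apply. Qed.

(** It is the preimage of V by the inverse chart, restricted to the open image
    of the chart. *)
Lemma chart_img_open i (V : set M) : open V -> open (chart_img i V).
Proof.
move=> oV; have [_ _ /(_ i)[_ oI _ _ cI] _] := manifoldP M.
have -> : chart_img i V = chart_img i setT `&` chart_inv i @^-1` V.
  apply/seteqP; split=> z /=.
    move=> [x [ix Vx] <-]; split; first by exists x.
    by rewrite /= chart_invK.
  by move=> [[x [ix _] <-]]; rewrite /= chart_invK// => Vx; exists x.
rewrite openE => z [Iz Vz].
have H : \forall y \near z, chart_img i setT y -> V (chart_inv i y).
  have := (@subspace_continuousP _ _ _ (chart_inv i)).1 cI _ Iz.
  by apply; exact: open_nbhs_nbhs.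
have oIz : nbhs z (chart_img i setT) by exact: open_nbhs_nbhs.
by apply: filterS2 H oIz => y Hy Iy; split=> //; exact: Hy.
Qed.

Lemma chart_inv_continuous i x : chart_dom i x ->
  {for chart_map i x, continuous (chart_inv i)}.
Proof.
move=> ix B; rewrite (chart_invK ix) nbhsE => -[V [oV Vx] VB].
have : nbhs (chart_map i x) (chart_img i V).
  by apply: open_nbhs_nbhs; split; [exact: chart_img_open|exists x].
by apply: filterS => _ [y [iy Vy] <-]; apply: VB; rewrite /= chart_invK.
Qed.

Lemma near_chart_img i x : chart_dom i x ->
  \forall z \near chart_map i x,
    chart_dom i (chart_inv i z) /\ chart_map i (chart_inv i z) = z.
Proof.
move=> ix; have : nbhs (chart_map i x) (chart_img i setT).
  by apply: open_nbhs_nbhs; split; [exact/chart_img_open/openT|exists x].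
by apply: filterS => _ [y [iy _] <-]; rewrite chart_invK.
Qed.

Lemma chart_map_continuous i x : chart_dom i x ->
  {for x, continuous (chart_map i)}.
Proof.
move=> ix; have [_ _ /(_ i)[oD _ _ cD _] _] := manifoldP M.
move=> B Bx; have H : \forall y \near x, chart_dom i y -> B (chart_map i y).
  exact: (@subspace_continuousP _ _ _ (chart_map i)).1 cD _ ix _ Bx.
have oDx : \forall y \near x, chart_dom i y by exact: open_nbhs_nbhs.
by apply: filterS2 H oDx => y Hy /Hy.
Qed.

Lemma compatible_manifold : compatible (matlas M).
Proof.
move=> i j p ip jp.
exists (chart_img i (chart_dom j)), (chart_map j \o chart_inv i); split.
- exact/chart_img_open/chart_dom_open.
- by exists p.
- by have [_ _ _] := manifoldP M; apply.
- move=> q _ iq [q' [iq' jq'] /(congr1 (chart_inv i))].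
  by rewrite !chart_invK// => <-; rewrite /= chart_invK.
Qed.

Lemma findim_cyl : findim (R * 'rV[R]_n)%type.
Proof. exact: findim_pair (findim_R) (findim_rV n). Qed.

(** Near an end point of [0,1], f is only controlled at times in [0,1], hence
    the restriction on p.1. *)
Lemma cyl_map_continuous (f : R * M -> M) t x (V : set M) :
  smooth_map (cyl_atlas (matlas M)) (matlas M) (@unitI R `*` setT) f ->
  unitI t -> open V -> V (f (t, x)) ->
  \forall p \near (t, x), unitI p.1 -> V (f p).
Proof.
move=> fs tI oV Vf; have StI x' t' :
    unitI t' -> (@unitI R `*` [set: M]) (t', x').
  by [].
have [i [k [ip kp [ O [g [ oO Op gs gE]]]]]] := fs (t, x) (StI x t tI).
change (chart_idx (matlas M)) in i; rewrite /= in ip Op gE.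
have [_ fE] := gE _ (StI x t tI) ip Op.
have gc := smooth_on_continuous gs Op.
have kc := chart_inv_continuous kp.
have ic : (fun p : R * M => (p.1, chart_map i p.2)) @ (t, x) -->
    (t, chart_map i x).
  have fc : (fun p : R * M => p.1) @ (t, x) --> t by exact: cvg_fst.
  have sc : (fun p : R * M => p.2) @ (t, x) --> x by exact: cvg_snd.
  have cc : (fun p : R * M => chart_map i p.2) @ (t, x) --> chart_map i x.
    exact: cvg_comp sc (chart_map_continuous ip).
  exact: (cvg_pair fc cc).
have n1 : \forall p \near (t, x), O (p.1, chart_map i p.2).
  by apply: ic; exact: open_nbhs_nbhs.
have n2 : \forall p \near (t, x), chart_dom i p.2.
  have sc : (fun p : R * M => p.2) @ (t, x) --> x by exact: cvg_snd.
  by apply: sc; apply: open_nbhs_nbhs; split=> //; exact: chart_dom_open.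
have n3 : \forall p \near (t, x), V (chart_inv k (g (p.1, chart_map i p.2))).
  have kV : nbhs (chart_map k (f (t, x))) (fun z => V (chart_inv k z)).
    by apply: kc; rewrite chart_invK//; exact: open_nbhs_nbhs.
  rewrite fE in kV.
  have gV : nbhs (t, chart_map i x) (fun z => V (chart_inv k (g z))) := gc _ kV.
  exact: ic _ gV.
near=> p => pI.
have ip' : chart_dom i p.2 by near: p.
have Op' : O (p.1, chart_map i p.2) by near: p.
have [//|kq qE] := gE p _ ip' Op'.
by rewrite -(chart_invK kq) qE /=; near: p.
Unshelve. all: by end_near. Qed.

End manifold.

(** * Complex-valued maps *)

Section complex_pairs.
Context {R : realType}.

Lemma c2K : cancel (@c2 R) (@r2c R). Proof. by case. Qed.
Lemma r2cK : cancel (@r2c R) (@c2 R). Proof. by case. Qed.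

Lemma c2D (z w : R[i]) : c2 (z + w) = c2 z + c2 w.
Proof. by case: z w => a b [c d]. Qed.
Lemma c2N (z : R[i]) : c2 (- z) = - c2 z.
Proof. by case: z. Qed.
Lemma c2B (z w : R[i]) : c2 (z - w) = c2 z - c2 w.
Proof. by rewrite c2D c2N. Qed.

(** The components of a product are polynomials in the real and imaginary parts
    of the factors. *)
Lemma smooth_on_cmul (E : normedModType R) (O : set E) (f g : E -> (R * R)%type) :
  open O -> smooth_on O f -> smooth_on O g ->
  smooth_on O (fun x => c2 (r2c (f x) * r2c (g x))).
Proof.
move=> oO fs gs k.
have f1 : Ck_on k O (fun x => (f x).1).
  by apply: (Ck_on_lin (l := fst) oO _ (fs k)) => x; exact: cvg_fst.
have f2 : Ck_on k O (fun x => (f x).2).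
  by apply: (Ck_on_lin (l := snd) oO _ (fs k)) => x; exact: cvg_snd.
have g1 : Ck_on k O (fun x => (g x).1).
  by apply: (Ck_on_lin (l := fst) oO _ (gs k)) => x; exact: cvg_fst.
have g2 : Ck_on k O (fun x => (g x).2).
  by apply: (Ck_on_lin (l := snd) oO _ (gs k)) => x; exact: cvg_snd.
apply: (@Ck_on_eq _ _ _ _ _ (fun x =>
    ((f x).1 * (g x).1 + (-1) * ((f x).2 * (g x).2),
     (f x).1 * (g x).2 + (f x).2 * (g x).1))) => //.
  by move=> x _; rewrite /c2 /r2c /= mulN1r.
apply: Ck_on_pair => //; apply: Ck_on_add => //; apply: Ck_on_scale => //.
  exact: Ck_on_cst.
exact: Ck_on_scale.
Qed.

End complex_pairs.

Section directional.
Context {R : realType}.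

Lemma derive_lin (E F G : normedModType R) (f : E -> F) (l : {linear F -> G}) x v :
  continuous l -> differentiable f x -> 'D_v (l \o f) x = l ('D_v f x).
Proof.
move=> lc df; have dl := @linear_differentiable _ _ _ _ (f x) lc.
rewrite deriveE; last exact: differentiable_comp.
by rewrite diff_comp //= diff_lin // deriveE.
Qed.

Lemma cvg_slice (E : normedModType R) (t : R) (z : E) :
  pair t @ z --> (t, z).
Proof. exact: (cvg_pair (cvg_cst t) cvg_id). Qed.

Lemma derive_slice (E F : normedModType R) (g : R * E -> F)
    (t : R) (z v : E) : differentiable g (t, z) ->
  differentiable (g \o pair t) z /\ 'D_v (g \o pair t) z = 'd g (t, z) (0, v).
Proof.
move=> dg; have ip : is_diff z (pair t) (fun y : E => (0 : R, y)).
  exact: (is_diff_pair (is_diff_cst t z) (is_diff_id z)).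
have dp : differentiable (pair t : E -> R * E) z by exact: ex_diff.
have dc := differentiable_comp dp dg.
split=> //; rewrite deriveE// [in LHS]diff_comp//.
by rewrite /comp (@diff_val _ _ _ _ _ _ _ ip).
Qed.

End directional.

Section quotient.
Context {R : realType}.
Local Notation C2 := (R * R)%type.

(** The inverse of a + i b is (a - i b) / (a^2 + b^2). *)
Lemma differentiable_cinv (v : C2) : r2c v != 0 ->
  differentiable (fun u : C2 => c2 (r2c u)^-1) v.
Proof.
case: v => a b; rewrite eq_complex /= => v0.
have fd : differentiable (fst : C2 -> R) (a, b).
  by apply: linear_differentiable => z; exact: cvg_fst.
have sd : differentiable (snd : C2 -> R) (a, b).
  by apply: linear_differentiable => z; exact: cvg_snd.
pose N (u : C2) := u.1 * u.1 + u.2 * u.2.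
have Nd : differentiable N (a, b).
  by apply: differentiableD; exact: differentiableM.
have N0 : N (a, b) != 0.
  rewrite /N /= -!expr2 paddr_eq0 ?sqr_ge0// !sqrf_eq0.
  by [].
have -> : (fun u : C2 => c2 (r2c u)^-1) =
    (fun u => (N u)^-1 *: (u.1, - u.2)).
  apply/funext => -[x y]; rewrite /c2 /r2c /N /= /GRing.scale /=.
  rewrite !expr2 /scale_pair /= /GRing.scale /= mulrN.
  by rewrite !(mulrC (_ + _)^-1).
apply: (differentiable_scale (differentiableV Nd N0) _).1.
by apply: differentiable_pair => //; exact: differentiableN.
Qed.

Lemma differentiable_cdiv (u v : C2) : r2c v != 0 ->
  differentiable (fun q : C2 * C2 => c2 (r2c q.1 / r2c q.2)) (u, v).
Proof.
move=> v0.
have md : differentiable (fun q : C2 * C2 => c2 (r2c q.1 * r2c q.2))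
    (u, c2 (r2c v)^-1).
  apply: (@smooth_on_differentiable _ _ _ setT) => //.
  by apply: smooth_on_cmul;
     [exact: openT|apply: smooth_on_fst|apply: smooth_on_snd]; exact: openT.
have -> : (fun q : C2 * C2 => c2 (r2c q.1 / r2c q.2)) =
  (fun q : C2 * C2 => c2 (r2c q.1 * r2c q.2)) \o
  (fun q => (q.1, c2 (r2c q.2)^-1)).
  by apply/funext => q /=; rewrite c2K.
apply: differentiable_comp => //=.
apply: differentiable_pair.
  by apply: linear_differentiable => z; exact: cvg_fst.
apply: (@differentiable_comp _ _ _ _ snd (fun u : C2 => c2 (r2c u)^-1)).
  by apply: linear_differentiable => z; exact: cvg_snd.
exact: differentiable_cinv.
Qed.

(** The quotient map is constant on the line through (a, b) with direction
    (m a, m b), since both components are multiplied by 1 + h m there; so its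
    differential vanishes in this direction, which is that of the curve. *)
Lemma deriv_within_ratio A (a b : R -> R[i]) t (m : R[i]) : b t != 0 ->
  has_deriv_within A (fun s => c2 (a s)) t (c2 (m * a t)) ->
  has_deriv_within A (fun s => c2 (b s)) t (c2 (m * b t)) ->
  has_deriv_within A (fun s => c2 (a s / b s)) t 0.
Proof.
move=> b0 da db.
have bn0 : r2c (c2 (b t)) != 0 by rewrite c2K.
have dQ := differentiable_cdiv (c2 (a t)) bn0.
have := deriv_within_comp (deriv_within_pair da db) dQ.
have -> : (fun q : C2 * C2 => c2 (r2c q.1 / r2c q.2)) \o
    (fun s => (c2 (a s), c2 (b s))) = fun s => c2 (a s / b s).
  by apply/funext => s /=; rewrite !c2K.
congr has_deriv_within; rewrite -deriveE// /derive.
apply: cvg_lim; first exact: norm_hausdorff.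
have H : \forall h \near 0^', 1 + h%:C%C * m != 0 :> R[i].
  have c1 : (fun h : R => 1 + h * complex.Re m) @ 0^' -->
      (1 + 0 * complex.Re m : R).
    apply: (@cvgD R R); first exact: cvg_cst.
    apply: (@cvgM R); last exact: cvg_cst.
    exact: cvg_within.
  rewrite mul0r addr0 in c1.
  have pos : \forall h \near 0^', 0 < 1 + h * complex.Re m.
    exact: (cvgr_gt _ c1 _ ltr01).
  apply: filterS pos => h h0.
  move: h0; case: (m) => m1 m2 /= h0.
  rewrite eq_complex negb_and /= mul0r subr0; apply/orP; left.
  by rewrite gt_eqF.
apply: (cvg_near_eq _ (cvg_cst 0)); near=> h => /=.
have mh : 1 + h%:C%C * m != 0 by near: h.
have E (z : R[i]) : r2c (h *: c2 (m * z) + c2 z) = (1 + h%:C%C * m) * z.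
  case: z (m) => [z1 z2] [m1 m2]; rewrite /r2c /c2 /= /GRing.scale /=.
  by apply/eqP; rewrite eq_complex /=; apply/andP; split; apply/eqP; ring.
by rewrite !E !c2K -mulf_div divff// mul1r subrr scaler0.
Unshelve. all: by end_near. Qed.

End quotient.

(** * Trivialisations, the connection form and the lifted field *)

Section bundle.
Context {R : realType} {n : nat} (M : manifold R n) (L : line_bundle M).
Implicit Types (i : chart_idx (matlas M)) (j : triv_idx L) (x : M).

Definition frame j : forall x, L x := fun x => triv_inv j x 1.
Arguments frame : clear implicits.

Lemma triv0 j x : triv_dom j x -> triv j (0 : L x) = 0.
Proof.
move=> jx; have := triv_linear jx 1 0 0; rewrite scaler0 addr0 mul1r => H.
by apply: (addrI (triv j (0 : L x))); rewrite addr0 -H.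
Qed.
Lemma trivD j x (l m : L x) : triv_dom j x -> triv j (l + m) = triv j l + triv j m.
Proof. by move=> jx; rewrite -{1}[l]scale1r triv_linear// mul1r. Qed.
Lemma trivZ j x c (l : L x) : triv_dom j x -> triv j (c *: l) = c * triv j l.
Proof. by move=> jx; rewrite -[c *: l]addr0 triv_linear// triv0// addr0. Qed.
Lemma trivN j x (l : L x) : triv_dom j x -> triv j (- l) = - triv j l.
Proof. by move=> jx; rewrite -scaleN1r trivZ// mulN1r. Qed.
Lemma triv_inj j x : triv_dom j x -> injective (@triv _ _ _ L j x).
Proof. by move=> jx; exact: can_inj (trivK jx). Qed.
Lemma triv_frame j x : triv_dom j x -> triv j (frame j x) = 1.
Proof. by move=> jx; rewrite triv_invK. Qed.
Lemma frameE j x (l : L x) : triv_dom j x -> l = triv j l *: frame j x.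
Proof. by move=> jx; apply: (triv_inj jx); rewrite trivZ// triv_frame// mulr1. Qed.

Lemma findim_tot : findim ('rV[R]_n * (R * R))%type.
Proof.
apply: findim_pair; first exact: findim_rV.
by apply: findim_pair; exact: findim_R.
Qed.

(** In the fibre the change of trivialisation is multiplication by the
    transition function triv j' (triv_inv j x 1), smooth by the axioms of a line
    bundle. *)
Lemma compatible_tot : compatible (tot_atlas L).
Proof.
move=> [i j] [i' j'] p /= [ip jp] [ip' jp'].
have [ O [g [oO Op gs gE]]] := compatible_manifold ip ip'.
have [ O' [h [oO' Op' hs hE]]] : smooth_at (matlas M) (vsp_atlas (R * R)%type)
    (triv_dom j' `&` triv_dom j) (fun x => c2 (triv j' (triv_inv j x 1)))
    i tt (base p).
  apply: smooth_map_at => //.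
  - exact: findim_rV.
  - by apply: findim_pair; exact: findim_R.
  - exact: compatible_manifold.
  - exact: compatible_vsp.
  - exact: triv_smooth.
(* The last factor forces a point with coordinates in Q to lie in both
   trivialising sets. *)
pose Q := O `&` O' `&` chart_img i (triv_dom j' `&` triv_dom j).
have oQ : open Q.
  apply: openI; first exact: openI.
  by apply: chart_img_open; apply: openI; exact: triv_open.
have oQ1 : open [set e : 'rV[R]_n * (R * R) | Q e.1] by exact: open_fst.
exists [set e | Q e.1], (fun e => (g e.1, c2 (r2c (h e.1) * r2c e.2))); split => //.
- by split=> //; exists (base p).
- apply: smooth_on_pair => //.
    apply: (smooth_on_comp (findim_rV n) oQ1 _ (smooth_on_fst oQ1) gs).
    by move=> e [[]].
  apply: smooth_on_cmul => //; last exact: smooth_on_snd.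
  apply: (smooth_on_comp (findim_rV n) oQ1 _ (smooth_on_fst oQ1) hs).
  by move=> e [[]].
- move=> q _ /= [iq jq] [[Oq O'q] [y [iy [j'y jy]] yq]].
  have {}yq : y = base q by rewrite -(chart_invK iy) yq chart_invK.
  rewrite {}yq in j'y jy iy *.
  have [iq' gq] := gE _ I iq Oq; have [_ hq] := hE _ (conj j'y jy) iq O'q.
  split=> //; rewrite gq -hq !c2K; congr (_, c2 _).
  by rewrite mulrC -trivZ//; congr triv; exact: frameE.
Qed.

Lemma smooth_frame j : smooth_section (triv_dom j) (frame j).
Proof.
move=> x jx; have [i ix] := chart_cover x.
exists i, (i, j); split=> //; exists setT, (fun z => (z, (1, 0))); split=> //.
- exact: openT.
- apply: smooth_on_pair; first exact: openT.
    exact: smooth_on_id.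
  exact: smooth_on_cst.
- by move=> q jq iq _; split=> //=; rewrite triv_frame.
Qed.

(** A smooth section in coordinates, together with its base point: the chart
    expression is differentiable because it agrees near the point with the
    smooth extension g. *)
Lemma section_local x (s : forall y, L y) i j :
  smooth_near x s -> chart_dom i x -> triv_dom j x ->
  exists2 g : 'rV[R]_n -> 'rV[R]_n * (R * R), differentiable g (chart_map i x) &
    \forall z \near chart_map i x,
      (z, c2 (triv j (s (chart_inv i z)))) = g z.
Proof.
move=> [U [oU Ux ss]] ix jx.
have [ O [g [oO Ox gs gE]]] : smooth_at (matlas M) (tot_atlas L) U
    (fun y => Tot L y (s y)) i (i, j) x.
  apply: smooth_map_at => //.
  - exact: findim_rV.
  - exact: findim_tot.
  - exact: compatible_manifold.
  - exact: compatible_tot.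
exists g; first exact: smooth_on_differentiable gs Ox.
(* The extension g only agrees with the section over U. *)
have n1 : \forall z \near chart_map i x, U (chart_inv i z).
  apply: (chart_inv_continuous ix); rewrite chart_invK//.
  exact: open_nbhs_nbhs.
have n2 : \forall z \near chart_map i x, O z by exact: open_nbhs_nbhs.
near=> z.
have [iz zE] : chart_dom i (chart_inv i z) /\ chart_map i (chart_inv i z) = z.
  by near: z; exact: near_chart_img.
have Uz : U (chart_inv i z) by near: z.
have Oz : O z by near: z.
have := gE _ Uz iz; rewrite zE => /(_ Oz)[_ /=].
by rewrite zE.
Unshelve. all: by end_near. Qed.

Lemma smooth_triv U j (s : forall y, L y) : smooth_section U s ->
  smooth_map (matlas M) (vsp_atlas (R * R)%type) (U `&` triv_dom j)
    (fun y => c2 (triv j (s y))).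
Proof.
move=> ss x [Ux jx]; have [i ix] := chart_cover x.
have [ O [g [oO Ox gs gE]]] : smooth_at (matlas M) (tot_atlas L) U
    (fun y => Tot L y (s y)) i (i, j) x.
  apply: smooth_map_at => //.
  - exact: findim_rV.
  - exact: findim_tot.
  - exact: compatible_manifold.
  - exact: compatible_tot.
exists i, tt; split=> //; exists O, (snd \o g); split=> //.
  by move=> k; apply: (Ck_on_lin (l := snd) oO _ (gs k)) => z; exact: cvg_snd.
by move=> q [Uq jq] iq Oq; have [_ /= <-] := gE _ Uq iq Oq.
Qed.

(** The Leibniz rule applied to s = (triv j s) e_j with e_j = frame j.  The factor
    triv j (D x v e_j) is the connection form of D in the trivialisation j,
    evaluated at v. *)
Lemma conn_triv (D : connection L) x i j (v : tvec M) (s : forall y, L y) :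
  chart_dom i x -> triv_dom j x -> is_tangent x v -> smooth_near x s ->
  triv j (D x v s) = r2c (along i v (fun y => c2 (triv j (s y))) x)
    + triv j (s x) * triv j (D x v (frame j)).
Proof.
move=> ix jx vx sx; have [U [oU Ux ss]] := sx.
pose U' := U `&` triv_dom j.
have oU' : open U' by apply: openI => //; exact: triv_open.
have U'x : U' x by [].
have fs : smooth_section U' (frame j).
  by apply: smooth_map_sub (@smooth_frame j) => y [].
have gs : smooth_map (matlas M) (vsp_atlas (R * R)%type) U'
    (@c2 R \o (fun y => triv j (s y))) by exact: smooth_triv.
have ss' : smooth_section U' (fun y => triv j (s y) *: frame j y).
  apply: (@smooth_map_eq _ _ _ _ _ _ _ U' (fun x => Tot L x (s x))).
    by move=> y [Uy jy]; rewrite -frameE.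
  by apply: smooth_map_sub ss => y [].
have sE : D x v s = D x v (fun y => triv j (s y) *: frame j y).
  apply: conn_local => //; first by exists U'.
  have : nbhs x (triv_dom j).
    by apply: open_nbhs_nbhs; split=> //; exact: triv_open.
  by apply: filterS => y jy; exact: frameE.
rewrite sE (conn_leibniz D oU' gs fs U'x ix vx) trivD// !trivZ//.
by rewrite triv_frame// mulr1.
Qed.

(** A local section s with D_v s = 0 has, by conn_triv, a coordinate whose
    derivative along v is minus the connection form times the coordinate. *)
Lemma hlift_components (D : connection L) (p : tot L) v xi i j :
  is_tangent (base p) v -> is_hlift D p v xi ->
  chart_dom i (base p) -> triv_dom j (base p) ->
  xi (i, j) = (v i, c2 (- (triv j (vec p) * triv j (D (base p) v (frame j))))).
Proof.
move=> vx [s [sx sp Ds [_ xiE]]] ix jx.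
have [g dg gE] := section_local sx ix jx.
have -> : xi (i, j) = 'D_(v i) g (chart_map i (base p)).
  have kx : chart_dom (a := tot_atlas L) (i, j) (Tot L (base p) (s (base p))).
    by split.
  rewrite (xiE i (i, j) ix kx) /along; apply: near_eq_derive.
  near=> z => /=.
  have [iz zE] : chart_dom i (chart_inv i z) /\ chart_map i (chart_inv i z) = z.
    by near: z; exact: near_chart_img.
  by rewrite zE; near: z.
rewrite [LHS]surjective_pairing; congr (_, _).
  rewrite -[LHS]/(fst ('D_(v i) g (chart_map i (base p)))).
  rewrite -derive_lin//; last by move=> y; exact: cvg_fst.
  rewrite -[RHS](derive_id (chart_map i (base p))).
  by apply: near_eq_derive; apply: filterS gE => z /= <-.
rewrite -[LHS]/(snd ('D_(v i) g (chart_map i (base p)))).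
rewrite -derive_lin//; last by move=> y; exact: cvg_snd.
have := conn_triv D ix jx vx sx; rewrite Ds triv0// => /eqP.
rewrite eq_sym addr_eq0 sp => /eqP <-; rewrite r2cK.
by apply: near_eq_derive; apply: filterS gE => z /= <-.
Unshelve. all: by end_near. Qed.

End bundle.

Section vertical.
Context {R : realType}.

Lemma is_derive_within (F : normedModType R) (A : set R) (g : R -> F) (t : R)
    (v : F) :
  is_derive t (1 : R) g v -> has_deriv_within A g t v.
Proof.
move=> [dg <-]; have dg' : differentiable g t by exact/derivable1_diffP.
rewrite deriveE//; exact: (deriv_within_comp (deriv_within_id A t) dg').
Qed.

Lemma deriv_setT_unique (F : normedModType R) (c : R -> F) (t : R) (v w : F) :
  has_deriv_within setT c t v -> has_deriv_within setT c t w -> v = w.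
Proof.
have PF : ProperFilter (within setT t^').
  apply: Build_ProperFilter_ex => P PP.
  have PP' : \forall s \near t^', [set: R] s -> P s := PP.
  have : \forall s \near t^', P s by apply: filterS PP' => s; apply.
  by move=> /filter_ex.
by move=> cv cw; exact: (cvg_unique (@norm_hausdorff R F) cv cw).
Qed.

Section cmul.
Variable m : R[i].
(** Multiplication by m on pairs, a linear map, so that it commutes with
    derivatives of curves. *)
Let cmulr (q : (R * R)%type) : (R * R)%type := c2 (r2c q * m).
Let cmulr_lin : linear cmulr.
Proof.
move=> a [x1 x2] [y1 y2]; rewrite /cmulr /r2c; case: m => m1 m2 /=.
by apply/pair_eqP/andP; split; apply/eqP; rewrite /= /GRing.scale /=; ring.
Qed.
HB.instance Definition _ :=
  GRing.isLinear.Build R (R * R)%type (R * R)%type _ cmulr cmulr_lin.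

Lemma deriv_within_cmul A (c : R -> (R * R)%type) t v :
  has_deriv_within A c t v ->
  has_deriv_within A (fun s => c2 (r2c (c s) * m)) t (c2 (r2c v * m)).
Proof.
move=> cv; apply: (@deriv_within_lin _ _ _ _ _ cmulr) => // q.
have sm : smooth_on setT cmulr.
  have := smooth_on_cmul openT (@smooth_on_id _ _ _) (smooth_on_cst _ (c2 m)).
  by rewrite c2K.
exact: smooth_on_continuous sm I.
Qed.
End cmul.

(** The curve exp(2 pi i t f) b has derivative 2 pi i f b at t = 0, and its base
    point is constant. *)
Lemma vertical_components n (M : manifold R n) (L : line_bundle M) (f : M -> R)
    (p : tot L) w (i : chart_idx (matlas M)) (j : triv_idx L) :
  is_W f p w -> chart_dom i (base p) -> triv_dom j (base p) ->
  w (i, j) = (0, c2 (twopii R * (f (base p))%:C%C * triv j (vec p))).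
Proof.
move=> [_ /(_ (i, j)) wd] ix jx.
have [//|_ {}wd] := wd.
apply: (deriv_setT_unique wd); set k := f (base p).
have dc : has_deriv_within setT
    (fun t => (cos (2 * pi * t * k), sin (2 * pi * t * k))) 0 (0, 2 * pi * k).
  apply: deriv_within_pair; apply: is_derive_within.
  - apply: is_derive_eq.
    by rewrite mulr0 mul0r sin0 oppr0 ?mulr0 ?mul0r ?scale0r.
  - apply: is_derive_eq; rewrite mulr0 mul0r cos0.
    by rewrite /GRing.scale /=; ring.
have -> : c2 (twopii R * k%:C%C * triv j (vec p)) =
    c2 (r2c (0, 2 * pi * k) * triv j (vec p)).
  congr (c2 (_ * _)); rewrite /twopii /r2c; apply/eqP; rewrite eq_complex /=.
  by apply/andP; split; apply/eqP; ring.
have dm := deriv_within_cmul (m := triv j (vec p)) dc.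
have -> : chart_map (a := tot_atlas L) (i, j) \o
    (fun t => act p (expi (2 * pi * t * f (base p)))) =
  fun t => (chart_map i (base p),
    c2 (r2c (cos (2 * pi * t * k), sin (2 * pi * t * k)) * triv j (vec p))).
  by apply/funext => t /=; rewrite trivZ.
by apply: deriv_within_pair => //; exact: deriv_within_cst.
Qed.

End vertical.

(** * Flows *)

Section curves.
Context {R : realType} {n : nat} (M : manifold R n).
Local Notation I := (@unitI R).

Lemma near_pair_chart A (t : R) (d : R -> M) (i : chart_idx (matlas M))
    (O : set (R * 'rV[R]_n)) v :
  has_deriv_within A (chart_map i \o d) t v -> open O ->
  O (t, chart_map i (d t)) ->
  \forall s \near within A (nbhs t), O (s, chart_map i (d s)).
Proof.
move=> dv oO Ot.
have := deriv_within_continuous (deriv_within_pair (deriv_within_id A t) dv).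
by apply; exact: open_nbhs_nbhs.
Qed.

(** The chain rule for s |-> f(s, d(s)), with f read in charts through its smooth
    extension g. *)
Lemma deriv_along_curve (F : normedModType R) (T : Type) (b : atlas F T)
    (S : set (R * M)) (f : R * M -> T) (i : chart_idx (matlas M))
    (k : chart_idx b) (O : set (R * 'rV[R]_n)) (g : R * 'rV[R]_n -> F)
    (d : R -> M) (t : R) v :
  open O -> smooth_on O g ->
  (forall q : R * M, S q -> chart_dom i q.2 -> O (q.1, chart_map i q.2) ->
    chart_dom k (f q) /\ chart_map k (f q) = g (q.1, chart_map i q.2)) ->
  S (t, d t) -> (\forall s \near within I (nbhs t), S (s, d s)) ->
  chart_dom i (d t) -> (\forall s \near within I (nbhs t), chart_dom i (d s)) ->
  O (t, chart_map i (d t)) ->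
  has_deriv_within I (chart_map i \o d) t v ->
  has_deriv_within I (fun s => chart_map k (f (s, d s))) t
    ('d g (t, chart_map i (d t)) (1, v)).
Proof.
move=> oO gs gE St Sn it i_n Ot dv.
have On := near_pair_chart dv oO Ot.
have dp := deriv_within_pair (deriv_within_id I t) dv.
have dg := smooth_on_differentiable gs Ot.
apply: (deriv_within_eq _ _ (deriv_within_comp dp dg)).
  by rewrite /=; have [_ ->] := gE (t, d t) St it Ot.
near=> s => /=.
have Ss : S (s, d s) by near: s.
have is_ : chart_dom i (d s) by near: s.
have Os : O (s, chart_map i (d s)) by near: s.
by have [_ ->] := gE (s, d s) Ss is_ Os.
Unshelve. all: by end_near. Qed.

(** The curve psi_s^-1(c(s)) has zero derivative.  In charts it is g(s, c(s)) with
    g the expression of (s, x) |-> psi_s^-1(x), so its derivative is the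
    differential of g at (s, c(s)) applied to (1, X_s).  The same vector is the
    derivative of r |-> psi_r^-1(psi_r(y)) for y = psi_s^-1(c(s)), and this curve
    is constant. *)
Lemma flow_unique (X : R -> M -> tvec M) (psi psi' : R -> M -> M) (c : R -> M) :
  isotopy (matlas M) setT psi psi' ->
  (forall t x, unitI t ->
    is_velocity (a := matlas M) I (psi^~ x) t (X t (psi t x))) ->
  (forall t, unitI t -> is_velocity (a := matlas M) I c t (X t (c t))) ->
  forall t, unitI t -> c t = psi t (c 0).
Proof.
move=> [psiS psiK _ psi's psi0] psiv cv t tI.
have I0 : I 0 by rewrite /unitI /= lexx ler01.
suff H : psi' t (c t) = c 0 by rewrite -H; have [_ ->] := psiK t (c t) tI Logic.I.
move: t tI; apply: unitI_ind; last first.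
  by have [+ _] := psiK 0 (c 0) I0 Logic.I; rewrite psi0.
move=> t tI.
have [i it] := chart_cover (c t); have [k kt] := chart_cover (psi' t (c t)).
have [ O [g [oO Ot gs gE]]] : smooth_at (cyl_atlas (matlas M)) (matlas M)
    (I `*` setT) (fun p => psi' p.1 p.2) i k (t, c t).
  apply: smooth_map_at => //.
  - exact: findim_cyl.
  - exact: findim_rV.
  - by apply: compatible_cyl; [exact: findim_rV|exact: compatible_manifold].
  - exact: compatible_manifold.
have [_ /(_ i it)[in_t dt]] := cv _ tI.
have On := near_pair_chart dt oO Ot.
have SI s (x : M) : I s -> (I `*` [set: M]) (s, x) by [].
have near_const : \forall s \near within I (nbhs t),
    chart_map k (psi' s (c s)) = chart_map k (psi' t (c t)).
  apply: (deriv_within0_near (c := fun s => chart_map k (psi' s (c s)))) => //.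
    exact: findim_rV.
  near=> s.
  have sI : I s by near: s; rewrite near_withinE; exact: nearW.
  have is_ : chart_dom i (c s) by near: s.
  have Os : O (s, chart_map i (c s)) by near: s.
  have nS (d : R -> M) :
      \forall r \near within I (nbhs s), (I `*` setT) (r, d r).
    by rewrite near_withinE; apply: nearW => r rI; exact: SI.
  have [_ /(_ i is_)[in_s ds]] := cv _ sI.
  have := deriv_along_curve (f := fun p => psi' p.1 p.2) oO gs gE
    (SI s (c s) sI) (nS c) is_ in_s Os ds.
  congr has_deriv_within.
  pose y := psi' s (c s); have ys : psi s y = c s.
    by have [_ ->] := psiK s (c s) sI Logic.I.
  (* The orbit through y has the same position and velocity at time s as c. *)
  have := psiv s y sI; rewrite ys => -[_]; rewrite ys => /(_ i is_)[in_y dy].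
  have iy : chart_dom i (psi s y) by rewrite ys.
  have Oy : O (s, chart_map i (psi s y)) by rewrite ys.
  have := deriv_along_curve (d := psi^~ y) (f := fun p => psi' p.1 p.2) oO gs gE
    (SI s (psi s y) sI) (nS _) iy in_y Oy dy.
  rewrite ys => dc; apply: (deriv_within_unique sI dc).
  apply: (deriv_within_eq _ _ (deriv_within_cst I (chart_map k y) s)).
    by rewrite /= ys.
  rewrite near_withinE; apply: nearW => r rI /=.
  by have [-> _] := psiK r y rI Logic.I.
near=> s.
have sI : I s by near: s; rewrite near_withinE; exact: nearW.
have is_ : chart_dom i (c s) by near: s.
have Os : O (s, chart_map i (c s)) by near: s.
have [ks _] := gE (s, c s) (SI s (c s) sI) is_ Os.
have E : chart_map k (psi' s (c s)) = chart_map k (psi' t (c t)) by near: s.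
by rewrite -(chart_invK ks) /= E chart_invK.
Unshelve. all: by end_near. Qed.

End curves.

(** * The lifted isotopy and the transported section *)

Section lift.
Context {R : realType} {n : nat} (M : manifold R n) (L : line_bundle M).
Variables (D : connection L) (f : R -> M -> R) (X : R -> M -> tvec M).
Local Notation I := (@unitI R).
Hypothesis Xtan : forall t x, I t -> is_tangent x (X t x).

(** Minus the connection form at X_t minus 2 pi i f_t: the factor by which the
    generator X_t^sharp - W_{f_t} multiplies the fibre coordinate. *)
Definition growth (t : R) (x : M) (j : triv_idx L) : R[i] :=
  - (triv j (D x (X t x) (frame j)) + twopii R * (f t x)%:C%C).

(** The derivative of a lifted orbit is X^sharp - W_f; its horizontal and
    vertical parts are computed in coordinates by hlift_components and
    vertical_components. *)
Lemma lift_velocity (F F' : R -> tot L -> tot L) p t i j :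
  is_lift D f X F F' -> Lx L p -> I t ->
  chart_dom i (base (F t p)) -> triv_dom j (base (F t p)) ->
  (\forall s \near within I (nbhs t),
     chart_dom i (base (F s p)) /\ triv_dom j (base (F s p))) /\
  has_deriv_within I
    (fun s => (chart_map i (base (F s p)), c2 (triv j (vec (F s p))))) t
    (X t (base (F t p)) i,
     c2 (growth t (base (F t p)) j * triv j (vec (F t p)))).
Proof.
move=> [[FS _ _ _ _] [Xs [W [Xsl Wl Fv]]]] pL tI ix jx.
have [FL _] := FS t p tI pL.
have [_ /(_ (i, j) (conj ix jx))[near_ dF]] := Fv t p tI pL.
split=> //; move: dF; congr has_deriv_within.
rewrite -[LHS]/(Xs t (F t p) (i, j) - W t (F t p) (i, j)).
rewrite (hlift_components (Xtan _ tI) (Xsl _ _ tI FL) ix jx).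
rewrite (vertical_components (Wl _ _ tI FL) ix jx).
congr (_, _); rewrite /= ?subr0// -c2B; congr c2.
by rewrite /growth; ring.
Qed.

(** The projection of a lifted orbit is an integral curve of X_t, hence an orbit
    of psi by flow_unique. *)
Lemma lift_base (F F' : R -> tot L -> tot L) (psi psi' : R -> M -> M) p t :
  isotopy (matlas M) setT psi psi' ->
  (forall t x, I t -> is_velocity (a := matlas M) I (psi^~ x) t (X t (psi t x))) ->
  is_lift D f X F F' -> Lx L p -> I t -> base (F t p) = psi t (base p).
Proof.
move=> ips psiv lF pL tI.
have F0 : F 0 p = p by have [[_ _ _ _ ->]] := lF.
rewrite (flow_unique (c := fun t => base (F t p)) ips psiv _ tI) ?F0//.
move=> s sI; split; first exact: Xtan.
move=> i ix; have [j jx] := triv_cover L (base (F s p)).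
have [near_ dF] := lift_velocity lF pL sI ix jx.
split; first by apply: filterS near_ => r [].
apply: (deriv_within_lin (l := fst) _ dF) => z; exact: cvg_fst.
Qed.

Lemma section_ofE (g : M -> tot L) x : base (g x) = x ->
  Tot L x (section_of g x) = g x.
Proof.
rewrite /section_of; case: pselect => // e _; move: e.
case: (g x) => y l /= e; by case: x / e.
Qed.

Lemma triv_eq_tot j (p q : tot L) : p = q -> triv j (vec p) = triv j (vec q).
Proof. by move=> ->. Qed.

Section family.
Variables (psi psi' : R -> M -> M) (U : set M).
Hypothesis ips : isotopy (matlas M) setT psi psi'.
Hypothesis psiv : forall t x, I t ->
  is_velocity (a := matlas M) I (psi^~ x) t (X t (psi t x)).
Hypothesis oU : open U.

Let S := [set p : R * M | I p.1 /\ (psi p.1 @` U) p.2].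

Lemma psiK t x : I t -> psi t (psi' t x) = x /\ psi' t (psi t x) = x.
Proof. by move=> tI; have [_ /(_ t x tI Logic.I)[-> ->]] := ips. Qed.

(** The set of pairs (t, x) with x in psi_t(U) is relatively open in [0,1] x M:
    it is the preimage of U by the continuous map (t, x) |-> psi_t^-1(x). *)
Lemma swept_near t x : I t -> (psi t @` U) x ->
  \forall p \near (t, x), I p.1 -> S p.
Proof.
move=> tI [y Uy yx].
have psi's : smooth_map (cyl_atlas (matlas M)) (matlas M) (I `*` setT)
  (fun p => psi' p.1 p.2) by have [] := ips.
have Ux : U (psi' (t, x).1 (t, x).2) by rewrite /= -yx (psiK _ tI).2.
have := cyl_map_continuous psi's tI oU Ux.
apply: filterS => -[s z] /= H sI; split=> //=; exists (psi' s z); first exact: H.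
by rewrite (psiK _ sI).1.
Qed.

Lemma image_open t : I t -> open (psi t @` U).
Proof.
move=> tI; rewrite openE => x Sx.
have H := swept_near tI Sx.
have c : (fun z : M => (t, z)) @ x --> (t, x).
  exact: (cvg_pair (cvg_cst t) cvg_id).
have Hz : \forall z \near x, I t -> S (t, z) := c _ H.
by apply: filterS Hz => z /(_ tI)[_].
Qed.

Section sigma.
Variable sig : R -> forall x, L x.
Hypothesis sigs : smooth_map (cyl_atlas (matlas M)) (tot_atlas L) S
  (fun p => Tot L p.2 (sig p.1 p.2)).

Lemma family_smooth_near t x : I t -> (psi t @` U) x -> smooth_near x (sig t).
Proof.
move=> tI Sx; exists (psi t @` U); split=> //; first exact: image_open.
have cc : compatible (cyl_atlas (matlas M)).
  by apply: compatible_cyl; [exact: findim_rV|exact: compatible_manifold].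
have sl := @smooth_map_slice _ _ _ (matlas M) (psi t @` U) t (@chart_cover _ _ M).
have SS : forall z, (psi t @` U) z -> S (t, z) by move=> z Uz; split.
have H := smooth_map_comp (@findim_cyl R n) cc SS sl sigs. exact: H.
Qed.

(** With g the coordinate expression of (s, x) |-> sigma_s(x), the three
    derivatives are the differential of g applied to (1, X_t), (1, 0) and
    (0, X_t). *)
Lemma total_derivative t y i j : I t -> U y ->
  chart_dom i (psi t y) -> triv_dom j (psi t y) ->
  exists2 P,
    has_deriv_within I (fun s => c2 (triv j (sig s (psi t y)))) t P &
    has_deriv_within I (fun s => c2 (triv j (sig s (psi s y)))) t
      (P + along i (X t (psi t y)) (fun z => c2 (triv j (sig t z))) (psi t y)).
Proof.
move=> tI Uy ix jx.
have St s : I s -> S (s, psi s y) by move=> sI; split=> //; exists y.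
have [ O [g [oO Ot gs gE]]] : smooth_at (cyl_atlas (matlas M)) (tot_atlas L)
    S (fun p => Tot L p.2 (sig p.1 p.2)) i (i, j) (t, psi t y).
  apply: smooth_map_at => //.
  - exact: findim_cyl.
  - exact: findim_tot.
  - by apply: compatible_cyl; [exact: findim_rV|exact: compatible_manifold].
  - exact: compatible_tot.
  - exact: St.
set x := psi t y in ix jx Ot *.
have Sx : (psi t @` U) x by exists y.
have sw := swept_near tI Sx.
have dg := smooth_on_differentiable gs Ot.
pose dg_ := 'd g (t, chart_map i x).
have sndc : continuous (@snd 'rV[R]_n (R * R)%type).
  by move=> z; exact: cvg_snd.
have lin1 : dg_ (1, X t x i) = dg_ (1, 0) + dg_ (0, X t x i).
  have -> : (1, X t x i) = (1, 0) + (0, X t x i) :> (R * 'rV[R]_n)%type.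
    by congr (_, _); rewrite /= ?addr0 ?add0r.
  by rewrite /dg_ raddfD.
exists (dg_ (1, 0)).2.
  have nS : \forall s \near within I (nbhs t), S (s, x).
    have c : (fun s : R => (s, x)) @ t --> (t, x).
      exact: (cvg_pair cvg_id (cvg_cst x)).
    by rewrite near_withinE; exact: c _ sw.
  have nix : \forall s \near within I (nbhs t), chart_dom i x.
    by rewrite near_withinE; exact: nearW.
  have := deriv_along_curve (d := fun=> x) oO gs gE (St t tI) nS ix nix Ot
    (deriv_within_cst I (chart_map i x) t).
  exact: (deriv_within_lin (l := snd)).
have -> : along i (X t x) (fun z => c2 (triv j (sig t z))) x = (dg_ (0, X t x i)).2.
  have [dgt dE] := derive_slice (X t x i) dg.
  rewrite /dg_ -dE.
  rewrite -[RHS]/(snd ('D_(X t x i) (g \o pair t) (chart_map i x))).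
  rewrite -(derive_lin _ sndc dgt).
  apply: near_eq_derive.
  have n1 : \forall z \near chart_map i x, (psi t @` U) (chart_inv i z).
    apply: (chart_inv_continuous ix); rewrite chart_invK//.
    by apply: open_nbhs_nbhs; split=> //; exact: image_open.
  have n2 : \forall z \near chart_map i x, O (t, z).
    have nO : nbhs (t, chart_map i x) O by exact: open_nbhs_nbhs.
    exact: (cvg_slice nO).
  near=> z => /=.
  have [iz zE] : chart_dom i (chart_inv i z) /\ chart_map i (chart_inv i z) = z.
    by near: z; exact: near_chart_img.
  have Uz : (psi t @` U) (chart_inv i z) by near: z.
  have Oz : O (t, z) by near: z.
  have := gE (t, chart_inv i z) (conj tI Uz) iz.
  by rewrite /= zE => /(_ Oz)[_ <-].
rewrite -[_ + _]/(snd (_ + _)) -lin1.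
have [_ /(_ i ix)[nix dt]] := psiv y tI.
have nS : \forall s \near within I (nbhs t), S (s, psi s y).
  by rewrite near_withinE; apply: nearW => s; exact: St.
have := deriv_along_curve (d := psi^~ y) oO gs gE (St t tI) nS ix nix Ot dt.
exact: (deriv_within_lin (l := snd)).
Unshelve. all: by end_near. Qed.

(** The equation for the family of sections, at a point, is equivalent to a scalar
    linear equation along the orbit through that point. *)
Lemma fib_deriv_total t y (i : chart_idx (matlas M)) (j : triv_idx L) :
  I t -> U y ->
  chart_dom i (psi t y) -> triv_dom j (psi t y) ->
  has_deriv_within I (fun s => c2 (triv j (sig s (psi t y)))) t
    (c2 (triv j (- D (psi t y) (X t (psi t y)) (sig t)
       - (twopii R * (f t (psi t y))%:C%C) *: sig t (psi t y)))) <->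
  has_deriv_within I (fun s => c2 (triv j (sig s (psi s y)))) t
    (c2 (growth t (psi t y) j * triv j (sig t (psi t y)))).
Proof.
move=> tI Uy ix jx; have [P dP dQ] := total_derivative tI Uy ix jx.
have Sx : (psi t @` U) (psi t y) by exists y.
have := conn_triv D ix jx (Xtan _ tI) (family_smooth_near tI Sx).
set K := triv j (D _ _ (sig t)); set al := along _ _ _ _ => KE.
have {}KE : al = c2 (K - triv j (sig t (psi t y)) *
    triv j (D (psi t y) (X t (psi t y)) (frame j))).
  by rewrite KE addrK r2cK.
have E : c2 (triv j (- D (psi t y) (X t (psi t y)) (sig t)
       - (twopii R * (f t (psi t y))%:C%C) *: sig t (psi t y))) =
   c2 (growth t (psi t y) j * triv j (sig t (psi t y))) - al.
  rewrite KE -c2B; congr c2; rewrite trivD// !trivN// trivZ// /growth -/K.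
  by ring.
rewrite E; split=> [dP'|dQ'].
  by have := dQ; rewrite (deriv_within_unique tI dP dP') subrK.
by have := dP; rewrite -(deriv_within_unique tI dQ dQ') addrK.
Qed.

End sigma.
(** Two families that solve the same scalar linear equation along an orbit have a
    locally constant quotient, in any trivialisation; the equality of their values
    therefore propagates from time 0. *)
Lemma linear_families_eq (sig tau : R -> forall x, L x) y :
  U y ->
  (forall t j, I t -> triv_dom j (psi t y) ->
     has_deriv_within I (fun s => c2 (triv j (sig s (psi s y)))) t
       (c2 (growth t (psi t y) j * triv j (sig t (psi t y))))) ->
  (forall t j, I t -> triv_dom j (psi t y) ->
     has_deriv_within I (fun s => c2 (triv j (tau s (psi s y)))) t
       (c2 (growth t (psi t y) j * triv j (tau t (psi t y))))) ->
  (forall t, I t -> tau t (psi t y) != 0) ->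
  sig 0 (psi 0 y) = tau 0 (psi 0 y) ->
  forall t, I t -> sig t (psi t y) = tau t (psi t y).
Proof.
move=> Uy dsig dtau tau0 st0; apply: unitI_ind => // t tI.
have [j jx] := triv_cover L (psi t y).
have psis : smooth_map (cyl_atlas (matlas M)) (matlas M) (I `*` setT)
  (fun p => psi p.1 p.2) by have [] := ips.
have nj : \forall s \near within I (nbhs t), triv_dom j (psi s y).
  have H := cyl_map_continuous (x := y) psis tI (@triv_open _ _ _ L j) jx.
  have c : (fun s : R => (s, y)) @ t --> (t, y).
    exact: (cvg_pair cvg_id (cvg_cst y)).
  by rewrite near_withinE; exact: c _ H.
have t0 s : I s -> triv_dom j (psi s y) -> triv j (tau s (psi s y)) != 0.
  move=> sI js; apply: contra (tau0 s sI) => /eqP E; apply/eqP.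
  by apply: (triv_inj js); rewrite triv0.
(* The trivialisation j is kept fixed near t; the factor growth is the same
   for both families, whatever its dependence on time. *)
have rc : \forall s \near within I (nbhs t),
    c2 (triv j (sig s (psi s y)) / triv j (tau s (psi s y))) =
    c2 (triv j (sig t (psi t y)) / triv j (tau t (psi t y))).
  apply: (deriv_within0_near (c := fun s =>
    c2 (triv j (sig s (psi s y)) / triv j (tau s (psi s y))))) => //.
    by apply: findim_pair; exact: findim_R.
  near=> s.
  have sI : I s by near: s; rewrite near_withinE; exact: nearW.
  have js : triv_dom j (psi s y) by near: s.
  exact: (deriv_within_ratio (a := fun s => triv j (sig s (psi s y)))
    (t0 s sI js) (dsig s j sI js) (dtau s j sI js)).
near=> s.
have sI : I s by near: s; rewrite near_withinE; exact: nearW.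
have js : triv_dom j (psi s y) by near: s.
have E : triv j (sig s (psi s y)) / triv j (tau s (psi s y)) =
    triv j (sig t (psi t y)) / triv j (tau t (psi t y)).
  by apply: (can_inj c2K); near: s.
have ratio r : I r -> triv_dom j (psi r y) ->
    sig r (psi r y) = tau r (psi r y) <->
    triv j (sig r (psi r y)) / triv j (tau r (psi r y)) = 1.
  move=> rI jr; have := t0 r rI jr => b0; split=> [->|/divr1_eq /(triv_inj jr) //].
  exact: divff.
by rewrite (ratio s sI js) (ratio t tI jx) E.
Unshelve. all: by end_near. Qed.

Variables (F F' : R -> tot L -> tot L) (tau : forall x, L x).
Hypothesis lF : is_lift D f X F F'.
Hypothesis taus : smooth_section U tau.
Hypothesis tau0 : forall x, U x -> tau x != 0.

Let taut t : forall x, L x := section_of (transport F psi' tau t).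

Lemma transport_tot t x : I t -> (psi t @` U) x ->
  Tot L x (taut t x) = transport F psi' tau t x.
Proof.
move=> tI [y Uy <-]; apply: section_ofE.
rewrite /transport (psiK y tI).2.
exact: (lift_base (p := Tot L y (tau y)) ips psiv lF (tau0 Uy) tI).
Qed.

(** The orbit of tau(y) under the lift is the value of the transported section
    at the moving point psi_t(y). *)
Lemma transport_flow t y : I t -> U y ->
  F t (Tot L y (tau y)) = Tot L (psi t y) (taut t (psi t y)).
Proof.
move=> tI Uy; have Sx : (psi t @` U) (psi t y) by exists y.
by rewrite (transport_tot tI Sx) /transport (psiK y tI).2.
Qed.

Lemma transport_neq0 t x : I t -> (psi t @` U) x -> taut t x != 0.
Proof.
move=> tI [y Uy <-]; have [[FS _ _ _ _] _] := lF.
have [+ _] := FS t (Tot L y (tau y)) tI (tau0 Uy).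
by rewrite transport_flow.
Qed.

Lemma transport_smooth :
  smooth_map (cyl_atlas (matlas M)) (tot_atlas L) S
    (fun p => Tot L p.2 (taut p.1 p.2)).
Proof.
apply: (smooth_map_eq (f := fun p => transport F psi' tau p.1 p.2)).
  by move=> p [pI Sp]; rewrite transport_tot.
have cM : compatible (cyl_atlas (matlas M)).
  by apply: compatible_cyl; [exact: findim_rV|exact: compatible_manifold].
have cL : compatible (cyl_atlas (tot_atlas L)).
  by apply: compatible_cyl; [exact: findim_tot|exact: compatible_tot].
have dL : findim (R * ('rV[R]_n * (R * R)))%type.
  by apply: findim_pair; [exact: findim_R|exact: findim_tot].
have [[_ _ Fs _ _] _] := lF.
have [_ _ _ psi's _] := ips.
have h1 : smooth_map (cyl_atlas (matlas M)) (cyl_atlas (matlas M)) S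
    (fun p => (p.1, psi' p.1 p.2)).
  by apply: smooth_map_cyl; apply: smooth_map_sub psi's => -[s x] [].
have h2 : smooth_map (cyl_atlas (matlas M)) (cyl_atlas (tot_atlas L))
    (I `*` U) (fun p => (p.1, Tot L p.2 (tau p.2))).
  apply: smooth_map_cyl.
  have sn := smooth_map_snd (S := I `*` U) (@chart_cover _ _ M).
  have sub : forall q : R * M, (I `*` U) q -> U q.2 by move=> q [].
  exact: (smooth_map_comp (findim_rV n) (@compatible_manifold _ _ M) sub sn taus).
have sub1 : forall q, S q -> (I `*` U) (q.1, psi' q.1 q.2).
  move=> [s x] [/= sI [y Uy /= <-]]; split=> //=.
  by rewrite (psiK y sI).2.
have h12 := smooth_map_comp (@findim_cyl R n) cM sub1 h1 h2.
have sub2 : forall q, S q -> (I `*` Lx L)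
    (((fun p : R * M => (p.1, Tot L p.2 (tau p.2))) \o
      (fun p => (p.1, psi' p.1 p.2))) q).
  by move=> q /sub1[qI Uq]; split=> //=; exact: tau0.
exact: (smooth_map_comp dL cL sub2 h12 Fs).
Qed.

(** The transported section satisfies the scalar equation because the lifted
    isotopy is generated by X^sharp - W_f. *)
Lemma transport_growth t y j : I t -> U y -> triv_dom j (psi t y) ->
  has_deriv_within I (fun s => c2 (triv j (taut s (psi s y)))) t
    (c2 (growth t (psi t y) j * triv j (taut t (psi t y)))).
Proof.
move=> tI Uy jx; have [i ix] := chart_cover (psi t y).
have FE := transport_flow _ Uy.
have := lift_velocity (i := i) (j := j) lF (tau0 Uy : Lx L (Tot L y (tau y))) tI.
rewrite FE//= => /(_ ix jx)[_ dF].
have dF2 : has_deriv_within I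
    (fun s => c2 (triv j (vec (F s (Tot L y (tau y)))))) t
    (c2 (growth t (psi t y) j * triv j (taut t (psi t y)))).
  by apply: (deriv_within_lin (l := snd) _ dF) => z; exact: cvg_snd.
apply: (deriv_within_eq _ _ dF2); first by rewrite FE.
by rewrite near_withinE; apply: nearW => s sI; rewrite FE.
Qed.

Lemma transport_solution : is_solution D f X psi U tau taut.
Proof.
split.
- exact: transport_smooth.
- move=> t x tI [y Uy <-] j jx; have [i ix] := chart_cover (psi t y).
  have [_ H] := fib_deriv_total transport_smooth tI Uy ix jx.
  exact: H (transport_growth tI Uy jx).
- move=> x Ux; have I0 : I 0 by rewrite /unitI /= lexx ler01.
  have [[_ _ _ _ F0] _] := lF; have [_ _ _ _ psi0] := ips.
  have := transport_flow I0 Ux; rewrite F0; last exact: tau0.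
  rewrite psi0// => E; have [j jx] := triv_cover L x.
  by apply: (triv_inj jx); rewrite (triv_eq_tot j E).
Qed.

Lemma solution_unique (sig : R -> forall x, L x) :
  is_solution D f X psi U tau sig ->
  forall t x, I t -> (psi t @` U) x -> sig t x = taut t x.
Proof.
move=> [sigs dsig sig0] t x tI [y Uy <-].
have [_ _ taut0] := transport_solution.
have [_ _ _ _ psi0] := ips.
apply: (linear_families_eq Uy _ _ _ _ tI).
- move=> s j sI jx; have [i ix] := chart_cover (psi s y).
  have [H _] := fib_deriv_total sigs sI Uy ix jx.
  by apply: H; apply: dsig => //; exists y.
- by move=> s j sI jx; exact: transport_growth.
- by move=> s sI; apply: transport_neq0 => //; exists y.
- by rewrite psi0// sig0// taut0.
Qed.

End family.
End lift.

Theorem proposition1 (R : realType) (n : nat) (M : manifold R n)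
  (w : symplectic_form M) (L : prequantum w)
  (f : R -> M -> R) (X : R -> M -> tvec M) (psi psi' : R -> M -> M)
  (F F' : R -> tot L -> tot L) (U : set M) (tau : forall x, L x) :
  compact [set: M] -> connected [set: M] ->
  hamiltonian_isotopy w f X psi psi' ->
  is_lift (pconn L) f X F F' ->
  open U -> smooth_section U tau -> (forall x, U x -> tau x != 0) ->
  let taut : R -> forall x, L x :=
    fun t => section_of (transport F psi' tau t) in
  [/\ forall t x, unitI t -> (psi t @` U) x ->
        Tot L x (taut t x) = transport F psi' tau t x /\ taut t x != 0,
      is_solution (pconn L) f X psi U tau taut &
      forall sigma : R -> forall x, L x,
        is_solution (pconn L) f X psi U tau sigma ->
        forall t x, unitI t -> (psi t @` U) x -> sigma t x = taut t x].
Proof.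
move=> _ _ [_ ips Xtan _ psiv] lF oU taus tau0 taut; split.
- move=> t x tI Sx; split.
    exact: (transport_tot Xtan ips psiv lF tau0 tI Sx).
  exact: (transport_neq0 Xtan ips psiv lF tau0 tI Sx).
- exact: (transport_solution Xtan ips psiv oU lF taus tau0).
- exact: (solution_unique Xtan ips psiv oU lF taus tau0).
Qed.
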